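(* Let $\mathcal{P} \in \mathcal{S}_\alpha^{\mathbf{k}}$ be a rank-$1$ tensor and let $p=(\lambda,\mathbf{u}_1,\ldots,\mathbf{u}_d) \in \otimes^{-1}(\mathcal{P})$ be any of its representatives in $\mathcal{P}_\alpha^{\mathbf{k}}$. Let $\dot{\mathcal{P}} \in \mathrm{T}_{\mathcal{P}} \mathcal{S}_\alpha^{\mathbf{k}}$, which can be expressed uniquely as $$\dot{\mathcal{P}} = \dot{\lambda}\,\mathcal{U} + \lambda\left( \nu_{k_1}(\dot{\mathbf{u}}_1)\otimes\mathbf{u}_2^{\otimes k_2}\otimes\cdots\otimes\mathbf{u}_d^{\otimes k_d} + \cdots + \mathbf{u}_1^{\otimes k_1}\otimes\cdots\otimes\mathbf{u}_{d-1}^{\otimes k_{d-1}}\otimes\nu_{k_d}(\dot{\mathbf{u}}_d) \right)$$ with $\dot\lambda\in\mathbb{R}$ and $\dot{\mathbf{u}}_i\in \mathrm{T}_{\mathbf{u}_i}\mathbb{S}^{n_i-1}$, where $$\mathcal{U} =\mathbf{u}_1^{\otimes k_1} \otimes \cdots \otimes \mathbf{u}_d^{\otimes k_d},\qquad \nu_{k_i}(\dot{\mathbf{u}}_i) = \dot{\mathbf{u}}_i \otimes\mathbf{u}_i^{\otimes (k_i - 1)} + \cdots + \mathbf{u}_i^{\otimes (k_i - 1)} \otimes \dot{\mathbf{u}}_i$$ (the sum of the $k_i$ terms in which exactly one factor $\mathbf{u}_i$ of $\mathbf{u}_i^{\otimes k_i}$ is replaced by $\dot{\mathbf{u}}_i$).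 Let $\dot{p}=(\dot{\lambda},\dot{\mathbf{u}}_1,\ldots,\dot{\mathbf{u}}_d) \in \mathrm{T}_p \mathcal{P}_\alpha^{\mathbf{k}}$ be the corresponding lifted tangent vector. Then $$\exp_{\mathcal{P}}(\dot{\mathcal{P}}) = \otimes\bigl( \exp_{p}(\dot{p}) \bigr),$$ insofar as $\dot{p}$ is in the domain of $\exp_p$. Here $\exp_{\mathcal P}$ is the exponential map of $\mathcal{S}_\alpha^{\mathbf{k}}$ at $\mathcal{P}$ and $\exp_p$ is the exponential map of $\mathcal{P}_\alpha^{\mathbf{k}}$ at $p$, given by the explicit formula recalled in the context.
   Context: Let $d\ge 1$, let $n_1,\dots,n_d$ and $k_1,\dots,k_d$ be positive integers, $\mathbf{k}=(k_1,\dots,k_d)$, and $\alpha>0$. $\mathbb{S}^{n-1}\subset\mathbb{R}^n$ is the unit sphere and $\langle\cdot,\cdot\rangle$ the Euclidean inner product. The $\alpha$-warped pre-Segre--Veronese manifold $\mathcal{P}_\alpha^{\mathbf{k}}$ is the manifold $\mathbb{R}_{>0}\times\mathbb{S}^{n_1-1}\times\cdots\times\mathbb{S}^{n_d-1}$ with the Riemannian metric $$g_{(\lambda,\mathbf{u}_1,\ldots,\mathbf{u}_d)}\bigl((\dot{x}, \dot{\mathbf{u}}_1, \ldots, \dot{\mathbf{u}}_d),(\dot{y}, \dot{\mathbf{v}}_1, \ldots, \dot{\mathbf{v}}_d)\bigr)=\dot{x} \dot{y} + (\alpha\lambda)^2 \sum_{i=1}^d k_i \langle \dot{\mathbf{u}}_i,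 \dot{\mathbf{v}}_i \rangle ,$$ the tangent space being $\mathbb{R}\times\mathbf{u}_1^\perp\times\cdots\times\mathbf{u}_d^\perp$. The $\alpha$-warped Segre--Veronese manifold $\mathcal{S}_\alpha^{\mathbf{k}}$ is the submanifold $\{\lambda\mathbf{u}_1^{\otimes k_1}\otimes\cdots\otimes\mathbf{u}_d^{\otimes k_d}\mid\lambda>0,\ \mathbf{u}_i\in\mathbb{S}^{n_i-1}\}$ of the punctured space $\mathbb{R}^{n_1^{k_1}\times\cdots\times n_d^{k_d}}\setminus\{0\}$ of real arrays, with the metric induced from the ambient metric $\varsigma^\alpha_{\lambda \mathcal{W}}(\dot{x}\,\mathcal{W}+\lambda\dot{\mathcal{V}},\dot{y}\,\mathcal{W}+\lambda\dot{\mathcal{V}}')=\dot{x}\dot{y}+(\alpha\lambda)^2\langle\dot{\mathcal{V}},\dot{\mathcal{V}}'\rangle$, where $\lambda>0$, $\|\mathcal{W}\|=1$, and $\dot{\mathcal{V}},\dot{\mathcal{V}}'\perp\mathcal{W}$. The map $\otimes:\mathcal{P}_\alpha^{\mathbf{k}}\to\mathcal{S}_\alpha^{\mathbf{k}}$ is $(\lambda,\mathbf{u}_1,\dots,\mathbf{u}_d)\mapsto\lambda\mathbf{u}_1^{\otimes k_1}\otimes\cdots\otimes\mathbf{u}_d^{\otimes k_d}$; elements of $\otimes^{-1}(\mathcal{P})$ are called representatives of $\mathcal{P}$. The exponential map of $\mathcal{P}_\alpha^{\mathbf{k}}$: with $N=\sqrt{\sum_i k_i\|\dot{\mathbf{u}}_i\|^2}$,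 if $N>0$ then $\exp_p(\dot p)=\bigl(\sqrt{(\lambda+\dot\lambda)^2+(\lambda\alpha N)^2},\exp^{\mathbb{S}}_{\mathbf{u}_1}(a\dot{\mathbf{u}}_1),\dots,\exp^{\mathbb{S}}_{\mathbf{u}_d}(a\dot{\mathbf{u}}_d)\bigr)$ with $a=\frac{1}{\alpha N}\bigl(\frac{\pi}{2}-\arctan\frac{\lambda+\dot\lambda}{\lambda\alpha N}\bigr)$; if $N=0$ and $\dot\lambda>-\lambda$ then $\exp_p(\dot p)=(\lambda+\dot\lambda,\mathbf{u}_1,\dots,\mathbf{u}_d)$; $\dot p$ is not in the domain when $N=0$ and $\dot\lambda\le-\lambda$. Here $\exp^{\mathbb{S}}_{\mathbf{u}}(\dot{\mathbf{u}})=\mathbf{u}\cos\|\dot{\mathbf{u}}\|+\frac{\dot{\mathbf{u}}}{\|\dot{\mathbf{u}}\|}\sin\|\dot{\mathbf{u}}\|$ (and $=\mathbf{u}$ if $\dot{\mathbf{u}}=0$). *)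

(* Defs.v *)
From mathcomp Require Import all_boot all_order all_algebra.
From mathcomp Require Import all_classical all_reals all_analysis.
Import Order.TTheory GRing.Theory Num.Theory.
Import numFieldNormedType.Exports.

Set Implicit Arguments.
Unset Strict Implicit.
Unset Printing Implicit Defensive.

Local Open Scope classical_set_scope.
Local Open Scope ring_scope.

(* Vectors of R^n and real arrays are both functions on a finite index type.  *)
(* The codomain is R^o (convertible to R), so that *: is available on arrays. *)
Definition array (R : realType) (I : finType) : Type := {ffun I -> R^o}.

Definition dot (R : realType) (I : finType) (x y : array R I) : R :=
  \sum_i x i * y i.

Definition enorm (R : realType) (I : finType) (x : array R I) : R :=
  Num.sqrt (dot x x).

Definition curve_derivable (R : realType) (I : finType)
    (c : R -> array R I) (t : R) : Prop :=
  forall i, derivable (fun s => c s i) t 1.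

Definition velocity (R : realType) (I : finType)
    (c : R -> array R I) (t : R) : array R I :=
  [ffun i => (derive1 (fun s => c s i) t : R^o)].

Definition dir_derive (R : realType) (I : finType)
    (f : array R I -> R) (x v : array R I) : R :=
  derive1 (fun s : R => f (x + s *: v) : R^o) 0.

(* A metric on (an open subset of) the flat space [array R I]: [g x] is the   *)
(* inner product at the point x.                                              *)
Definition metric (R : realType) (I : finType) : Type :=
  array R I -> array R I -> array R I -> R.

(* Christoffel symbols of the first kind in the global flat coordinates,      *)
(* contracted with v, w, z: for vector fields extending v and w with constant *)
(* coefficients, this is g_x(nabla_v w, z), by the Koszul formula.            *)
Definition christoffel (R : realType) (I : finType) (g : metric R I)
    (x v w z : array R I) : R :=
  2^-1 * (dir_derive (fun y => g y w z) x v
        + dir_derive (fun y => g y v z) x w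
        - dir_derive (fun y => g y v w) x z).

(* g(nabla_{c'} c', z) at time t, for the Levi-Civita connection nabla of g   *)
Definition cov_acceleration (R : realType) (I : finType) (g : metric R I)
    (c : R -> array R I) (t : R) (z : array R I) : R :=
  g (c t) (velocity (velocity c) t) z
  + christoffel g (c t) (velocity c t) (velocity c t) z.

(* The tangent space at x of a submanifold S of the flat space *)
Definition tangent_space (R : realType) (I : finType) (S : set (array R I))
    (x : array R I) : set (array R I) :=
  [set v | exists c : R -> array R I,
     [/\ \forall t \near (0 : R), S (c t), curve_derivable c 0,
         c 0 = x & velocity c 0 = v]].

(* Geodesics, on an open interval, of the submanifold S with the metric       *)
(* induced by g.  The Levi-Civita connection of the induced metric is the     *)
(* g-orthogonal projection on the tangent spaces of S of that of g, so that   *)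
(* nabla^S_{c'} c' = 0 says that nabla_{c'} c' is g-orthogonal to T_{c t} S.  *)
Definition geodesic_on (R : realType) (I : finType) (g : metric R I)
    (S : set (array R I)) (a b : R) (c : R -> array R I) : Prop :=
  forall t : R, a < t < b ->
    [/\ S (c t), curve_derivable c t, curve_derivable (velocity c) t
      & forall z, tangent_space S (c t) z -> cov_acceleration g c t z = 0].

Definition geodesic_from (R : realType) (I : finType) (g : metric R I)
    (S : set (array R I)) (x v : array R I) (c : R -> array R I) : Prop :=
  [/\ exists2 e : R, 0 < e & geodesic_on g S (- e) (1 + e) c,
      c 0 = x & velocity c 0 = v].

Definition exp_domain (R : realType) (I : finType) (g : metric R I)
    (S : set (array R I)) (x : array R I) : set (array R I) :=
  [set v | exists c, geodesic_from g S x v c].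

(* The value at time 1 of the geodesic with initial data x, v (the junk value *)
(* 0 outside of exp_domain)                                                   *)
Definition exp_map (R : realType) (I : finType) (g : metric R I)
    (S : set (array R I)) (x v : array R I) : array R I :=
  xget (0 : array R I) [set y | exists2 c, geodesic_from g S x v c & c 1 = y].

(* The decomposition x = lambda W, v = (radial x v) W + lambda (angular x v)  *)
(* with lambda = |x|, |W| = 1 and (angular x v) orthogonal to W, for x != 0   *)
Definition direction (R : realType) (I : finType) (x : array R I) : array R I :=
  (enorm x)^-1 *: x.

Definition radial (R : realType) (I : finType) (x v : array R I) : R :=
  dot v (direction x).

Definition angular (R : realType) (I : finType) (x v : array R I) : array R I :=
  (enorm x)^-1 *: (v - radial x v *: direction x).

Definition warped_metric (R : realType) (I : finType) (alpha : R) : metric R I :=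
  fun x v w =>
    radial x v * radial x w
    + (alpha * enorm x) ^+ 2 * dot (angular x v) (angular x w).

Definition vec (R : realType) (n : nat) : Type := array R 'I_n.

Definition power_tensor (R : realType) (n m : nat) : Type :=
  array R {ffun 'I_m -> 'I_n}.

(* Multi-indices of arrays of size n_1^{k_1} x ... x n_d^{k_d}: J i j is the   *)
(* index in the j-th of the k_i factors R^{n_i} of the i-th block.            *)
Definition tensor_index (d : nat) (n k : 'I_d -> nat) : finType :=
  {dffun forall i : 'I_d, {ffun 'I_(k i) -> 'I_(n i)}}.

Definition tensor (R : realType) (d : nat) (n k : 'I_d -> nat) : Type :=
  array R (tensor_index n k).

Definition tensor_prod (R : realType) (d : nat) (n k : 'I_d -> nat)
    (A : forall i, power_tensor R (n i) (k i)) : tensor R n k :=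
  [ffun J : tensor_index n k => \prod_i A i (J i)].

Definition vec_prod (R : realType) (n m : nat) (v : 'I_m -> vec R n) :
    power_tensor R n m :=
  [ffun J : {ffun 'I_m -> 'I_n} => \prod_j v j (J j)].

Definition vec_power (R : realType) (n m : nat) (u : vec R n) :
    power_tensor R n m :=
  vec_prod (fun _ => u).

Definition nu (R : realType) (n m : nat) (u du : vec R n) :
    power_tensor R n m :=
  \sum_(j < m) vec_prod (fun l => if l == j then du else u).

(* (lambda, u_1, ..., u_d), used both for points of R x R^{n_1} x ... x       *)
(* R^{n_d} and for tangent vectors                                            *)
Definition pre_point (R : realType) (d : nat) (n : 'I_d -> nat) : Type :=
  (R * (forall i, vec R (n i)))%type.

Definition pre_segre_veronese (R : realType) (d : nat) (n : 'I_d -> nat) :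
    set (pre_point R n) :=
  [set p | 0 < p.1 /\ forall i, enorm (p.2 i) = 1].

Definition pre_tangent (R : realType) (d : nat) (n : 'I_d -> nat)
    (p : pre_point R n) : set (pre_point R n) :=
  [set dp | forall i, dot (p.2 i) (dp.2 i) = 0].

Definition segre (R : realType) (d : nat) (n k : 'I_d -> nat)
    (p : pre_point R n) : tensor R n k :=
  p.1 *: tensor_prod (fun i => vec_power (k i) (p.2 i)).

Definition segre_veronese (R : realType) (d : nat) (n k : 'I_d -> nat) :
    set (tensor R n k) :=
  [set segre k p | p in @pre_segre_veronese R d n].

Definition tangent_expr (R : realType) (d : nat) (n k : 'I_d -> nat)
    (p dp : pre_point R n) : tensor R n k :=
  dp.1 *: tensor_prod (fun i => vec_power (k i) (p.2 i))
  + p.1 *: \sum_(i < d) tensor_prod (fun j =>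
      if j == i then nu (k j) (p.2 j) (dp.2 j) else vec_power (k j) (p.2 j)).

Definition lifted_tangent (R : realType) (d : nat) (n k : 'I_d -> nat)
    (p : pre_point R n) (dP : tensor R n k) (dp : pre_point R n) : Prop :=
  pre_tangent p dp /\ dP = tangent_expr k p dp.

Definition sphere_exp (R : realType) (n : nat) (u du : vec R n) : vec R n :=
  if du == 0 then u
  else cos (enorm du) *: u + (sin (enorm du) / enorm du) *: du.

Definition weighted_norm (R : realType) (d : nat) (n k : 'I_d -> nat)
    (dp : pre_point R n) : R :=
  Num.sqrt (\sum_(i < d) (k i)%:R * enorm (dp.2 i) ^+ 2).

Definition pre_exp_domain (R : realType) (d : nat) (n k : 'I_d -> nat)
    (p : pre_point R n) : set (pre_point R n) :=
  [set dp | 0 < weighted_norm k dp \/ - p.1 < dp.1].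

Definition pre_exp (R : realType) (d : nat) (n k : 'I_d -> nat) (alpha : R)
    (p dp : pre_point R n) : pre_point R n :=
  let N := weighted_norm k dp in
  if 0 < N then
    let a := (alpha * N)^-1
             * (pi / 2 - atan ((p.1 + dp.1) / (p.1 * alpha * N))) in
    (Num.sqrt ((p.1 + dp.1) ^+ 2 + (p.1 * alpha * N) ^+ 2),
     fun i => sphere_exp (p.2 i) (a *: dp.2 i))
  else (p.1 + dp.1, p.2).

(* Main.v *)
Require Import Defs.
From mathcomp Require Import all_boot all_order all_algebra.
From mathcomp Require Import all_classical all_reals all_analysis.
From mathcomp Require Import ring lra.
Import Order.TTheory GRing.Theory Num.Theory.
Import numFieldNormedType.Exports.

Set Implicit Arguments.
Unset Strict Implicit.
Unset Printing Implicit Defensive.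

Local Open Scope classical_set_scope.
Local Open Scope ring_scope.

(* The cone S is invariant under dilations and under the product of the
   orthogonal groups O(n_i), which act by isometries. Testing the geodesic
   equation of a curve c on S against the tangent vectors c, c' and X_A c, where
   A = (A_i) is a family of skew matrices and X_A its infinitesimal action on
   tensors, shows that |c|^2 is a quadratic polynomial in time (conservation of
   energy) and that the matrices |c|^2 (u_i' u_i^T - u_i u_i'^T) are constant
   (Noether). Hence c solves a linear first-order equation
   c' = (h/rho) c + (1/rho) X_Omega c with rho = |c|^2, h = rho'/2 and X_Omega
   skew; for the difference D of two solutions |D|^2/rho is constant, so c is
   determined by its initial data. Conversely, rotating each u_i in the plane
   spanned by u_i and its initial velocity w_i by the angle |w_i| phi(t), where
   phi' = lambda^2/rho, gives a geodesic, and phi(1) is the constant a in the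
   formula of pre_exp. *)

(** * Euclidean arrays and elementary tensors *)

Section Dot.
Context {R : realType} {I : finType}.
Implicit Types (x y z : array R I) (a : R).

Lemma dotC x y : dot x y = dot y x.
Proof. by apply: eq_bigr => i _; rewrite mulrC. Qed.

Lemma dotDl x y z : dot (x + y) z = dot x z + dot y z.
Proof. by rewrite /dot -big_split; apply: eq_bigr => i _; rewrite ffunE mulrDl. Qed.

Lemma dotZl a x y : dot (a *: x) y = a * dot x y.
Proof. by rewrite /dot mulr_sumr; apply: eq_bigr => i _; rewrite ffunE -mulrA. Qed.

Lemma dotDr x y z : dot z (x + y) = dot z x + dot z y.
Proof. by rewrite dotC dotDl !(dotC z). Qed.

Lemma dotZr a x y : dot x (a *: y) = a * dot x y.
Proof. by rewrite dotC dotZl dotC. Qed.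

Lemma dotNl x y : dot (- x) y = - dot x y.
Proof. by rewrite -scaleN1r dotZl mulN1r. Qed.

Lemma dotBl x y z : dot (x - y) z = dot x z - dot y z.
Proof. by rewrite dotDl dotNl. Qed.

Lemma dotBr x y z : dot z (x - y) = dot z x - dot z y.
Proof. by rewrite dotC dotBl !(dotC z). Qed.

Lemma dot0l x : dot 0 x = 0.
Proof. by rewrite -(scale0r 0) dotZl mul0r. Qed.

Lemma dot_suml (J : finType) (F : J -> array R I) y :
  dot (\sum_j F j) y = \sum_j dot (F j) y.
Proof.
elim/big_rec2: _ => [|j a x _ <-]; first by rewrite dot0l.
by rewrite dotDl.
Qed.

Lemma dot_sumr (J : finType) (F : J -> array R I) y :
  dot y (\sum_j F j) = \sum_j dot y (F j).
Proof. by rewrite dotC dot_suml; apply: eq_bigr => j _; rewrite dotC. Qed.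

Lemma dot_ge0 x : 0 <= dot x x.
Proof. by apply: sumr_ge0 => i _; rewrite -expr2 sqr_ge0. Qed.

Lemma dot_eq0 x : dot x x = 0 -> x = 0.
Proof.
move=> /eqP; rewrite psumr_eq0 => [/allP h|i _]; last by rewrite -expr2 sqr_ge0.
apply/ffunP => i; rewrite ffunE; apply/eqP.
by have := h i; rewrite mem_index_enum mulf_eq0 orbb => /(_ isT).
Qed.

Lemma sqr_enorm x : enorm x ^+ 2 = dot x x.
Proof. exact/sqr_sqrtr/dot_ge0. Qed.

Lemma enorm_ge0 x : 0 <= enorm x.
Proof. exact: sqrtr_ge0. Qed.

Lemma enormZ a x : enorm (a *: x) = `|a| * enorm x.
Proof.
by rewrite /enorm dotZl dotZr mulrA -expr2 sqrtrM ?sqr_ge0// sqrtr_sqr.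
Qed.

Lemma enorm_unit x : enorm x = 1 <-> dot x x = 1.
Proof.
split=> [h|h]; first by rewrite -sqr_enorm h expr1n.
by rewrite /enorm h sqrtr1.
Qed.

End Dot.

(** * Elementary tensors, indexed by slots *)

Section Tensors.
Context (R : realType) {d : nat} (n k : 'I_d -> nat).

(* A slot is one of the sum_i k_i vector factors of the tensor product. *)
Definition slot : finType := {i : 'I_d & 'I_(k i)}.

Definition slot_family : Type := forall s : slot, vec R (n (tag s)).

Definition block_family (u : forall i, vec R (n i)) : slot_family :=
  fun s => u (tag s).

Definition elementary (v : slot_family) : tensor R n k :=
  [ffun J : tensor_index n k => \prod_s v s (J (tag s) (tagged s))].

(** The replacement is read from a whole family [w], so that no vector has to be transported along
    an equality of slots. *)
Definition replace (s : slot) (w v : slot_family) : slot_family :=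
  fun s' => if s' == s then w s' else v s'.

(** The differential at [v], in the direction [w], of the multilinear map [elementary]. *)
Definition elementary_diff (v w : slot_family) : tensor R n k :=
  \sum_s elementary (replace s w v).

Lemma big_slot (T : Type) (e : T) (op : Monoid.com_law e) (F : slot -> T) :
  \big[op/e]_s F s =
  \big[op/e]_i \big[op/e]_(j < k i) F (Tagged (fun i => 'I_(k i)) j).
Proof.
rewrite (sig_big_dep predT (fun _ _ => true)
  (fun i (j : 'I_(k i)) => F (Tagged (fun i => 'I_(k i)) j))).
by apply: eq_bigr => -[].
Qed.

Lemma sum_slot_tag (f : 'I_d -> R) :
  \sum_(s : slot) f (tag s) = \sum_i (k i)%:R * f i.
Proof.
rewrite big_slot; apply: eq_bigr => i _ /=.
by rewrite sumr_const card_ord mulr_natl.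
Qed.

(** Elements of [fprod T] are functions into the disjoint union of the [T i], which reduces the
    claim to the distributive law for non-dependent functions. *)
Lemma sum_prod_dffun (T : 'I_d -> finType) (F : forall i, T i -> R) :
  \sum_(J : {dffun forall i, T i}) \prod_i F i (J i) =
  \prod_i \sum_(b : T i) F i b.
Proof.
rewrite (reindex (@dffun_of_fprod _ T)) /=; last first.
  exact/onW_bij/dffun_of_fprod_bij.
pose P i := [ffun b : T i => F i b].
transitivity (\sum_(t : fprod T) \prod_(i in 'I_d) P i (t i)).
  by apply: eq_bigr => t _; apply: eq_bigr => i _; rewrite !ffunE.
rewrite big_fprod.
transitivity (\prod_i \sum_(b in tagged_with T i) untag 0 (P i) b); last first.
  apply: eq_bigr => i _; rewrite -(big_tag (fun i b => P i b)).
  by apply: eq_bigr => b _; rewrite ffunE.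
by rewrite (bigA_distr_big_dep (fun i => mem (tagged_with T i))).
Qed.

(** A multi-index is an independent choice of one index per slot: distributivity is used once across
    the blocks and once inside each block. *)
Lemma sum_prod_slot (F : forall s : slot, 'I_(n (tag s)) -> R) :
  \sum_(J : tensor_index n k) \prod_s F s (J (tag s) (tagged s)) =
  \prod_s \sum_b F s b.
Proof.
rewrite [RHS]big_slot /=.
pose G i (g : {ffun 'I_(k i) -> 'I_(n i)}) : R :=
  \prod_j F (Tagged (fun i => 'I_(k i)) j) (g j).
transitivity (\sum_(J : tensor_index n k) \prod_i G i (J i)).
  by apply: eq_bigr => J _; rewrite big_slot.
rewrite sum_prod_dffun; apply: eq_bigr => i _.
by rewrite bigA_distr_bigA.
Qed.

Lemma dot_elementary (v w : slot_family) :
  dot (elementary v) (elementary w) = \prod_s dot (v s) (w s).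
Proof.
rewrite -[RHS](@sum_prod_slot (fun s b => v s b * w s b)).
by apply: eq_bigr => J _; rewrite !ffunE big_split.
Qed.

Lemma prod_replace (s : slot) (f g : slot -> R) :
  \prod_t (if t == s then f t else g t) = f s * \prod_(t | t != s) g t.
Proof.
rewrite (bigD1 s) //= eqxx; congr (_ * _).
by apply: eq_bigr => t /negPf ->.
Qed.

Lemma dot_replacel (s : slot) (w v y : slot_family) :
  dot (elementary (replace s w v)) (elementary y) =
  dot (w s) (y s) * \prod_(t | t != s) dot (v t) (y t).
Proof.
rewrite dot_elementary -(prod_replace s (fun t => dot (w t) (y t))).
by apply: eq_bigr => t _; rewrite /replace; case: eqP.
Qed.

Section Orthonormal.
Variable v : slot_family.
Hypothesis v1 : forall s, dot (v s) (v s) = 1.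

Lemma dot_elementary_unit : dot (elementary v) (elementary v) = 1.
Proof. by rewrite dot_elementary big1. Qed.

Lemma dot_replace_unit s w : dot (elementary (replace s w v)) (elementary v) = dot (w s) (v s).
Proof. by rewrite dot_replacel big1 ?mulr1. Qed.

Lemma dot_diff_unit w : (forall s, dot (w s) (v s) = 0) ->
  dot (elementary_diff v w) (elementary v) = 0.
Proof.
by move=> wv; rewrite dot_suml big1 // => s _; rewrite dot_replace_unit.
Qed.

Lemma dot_replace2 s t w y : (forall s, dot (w s) (v s) = 0) ->
  (forall s, dot (y s) (v s) = 0) ->
  dot (elementary (replace s w v)) (elementary (replace t y v)) =
  if s == t then dot (w s) (y s) else 0.
Proof.
move=> wv yv; rewrite dot_replacel.
have [->|st] := eqVneq s t.
  rewrite {1}/replace eqxx big1 ?mulr1 // => r /negPf rt.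
  by rewrite /replace rt.
by rewrite {1}/replace (negPf st) wv mul0r.
Qed.

(** Terms varying different slots are orthogonal. On block families the remaining sum over slots
    counts block i with weight [k i], as in the metric of the pre-Segre-Veronese manifold. *)
Lemma dot_diff2 w y : (forall s, dot (w s) (v s) = 0) ->
  (forall s, dot (y s) (v s) = 0) ->
  dot (elementary_diff v w) (elementary_diff v y) = \sum_s dot (w s) (y s).
Proof.
move=> wv yv; rewrite dot_suml; apply: eq_bigr => s _.
rewrite dot_sumr (bigD1 s) //= dot_replace2 // eqxx big1 ?addr0 // => t ts.
by rewrite dot_replace2 // eq_sym (negPf ts).
Qed.

(* Two slots differ from v on the left and at most one on the right, so some
   factor of the inner product is of the form <w, v> = 0. *)
Lemma dot_replace_replace s t w x y : s != t -> (forall s, dot (w s) (v s) = 0) ->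
  (forall s, dot (x s) (v s) = 0) ->
  dot (elementary (replace t x (replace s w v))) (elementary v) = 0 /\
  dot (elementary (replace t x (replace s w v))) (elementary_diff v y) = 0.
Proof.
move=> st wv xv; split; first by rewrite dot_replacel xv mul0r.
rewrite dot_sumr big1 // => r _; rewrite dot_replacel.
have [tr|tr] := eqVneq t r; last by rewrite {1}/replace (negPf tr) xv mul0r.
rewrite (bigD1 s) //= /replace eqxx -tr (negPf st) wv; ring.
Qed.

End Orthonormal.

(** * Infinitesimal action of a family of matrices on tensors *)

Section KroneckerSum.
Variable A : forall s : slot, 'I_(n (tag s)) -> 'I_(n (tag s)) -> R.

Definition mat_act (v : slot_family) : slot_family :=
  fun s => [ffun a => \sum_b A a b * v s b].

(** Matrix entries of the Kronecker sum of the [A s], that is, the sum over s of [A s] in slot s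
    times the identity in the other slots. The action is thus defined on all tensors, in particular
    on differences of curves in the cone. *)
Definition kronecker_coef (J K : tensor_index n k) : R :=
  \sum_s \prod_t (if t == s then A (J (tag t) (tagged t)) (K (tag t) (tagged t))
                  else (J (tag t) (tagged t) == K (tag t) (tagged t))%:R).

Definition kronecker_act (x : tensor R n k) : tensor R n k :=
  [ffun J => \sum_K kronecker_coef J K * x K].

Lemma kronecker_actD x y :
  kronecker_act (x + y) = kronecker_act x + kronecker_act y.
Proof.
apply/ffunP => J; rewrite !ffunE -big_split.
by apply: eq_bigr => K _; rewrite ffunE mulrDr.
Qed.

Lemma kronecker_actZ a x : kronecker_act (a *: x) = a *: kronecker_act x.
Proof.
apply/ffunP => J; rewrite !ffunE /GRing.scale/= mulr_sumr.
by apply: eq_bigr => K _; rewrite ffunE mulrCA.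
Qed.

(** In the summand of slot s the sum over K factorises over slots, and the Kronecker deltas return
    [v] in every slot other than s. *)
Lemma kronecker_act_elementary (v : slot_family) :
  kronecker_act (elementary v) = elementary_diff v (mat_act v).
Proof.
apply/ffunP => J; rewrite !ffunE /elementary_diff.
under eq_bigr do rewrite big_distrl /=.
rewrite exchange_big /= sum_ffunE; apply: eq_bigr => s _.
rewrite ffunE.
pose F (t : slot) (b : 'I_(n (tag t))) : R :=
  (if t == s then A (J (tag t) (tagged t)) b
                  else (J (tag t) (tagged t) == b)%:R) * v t b.
transitivity (\sum_(K : tensor_index n k) \prod_t F t (K (tag t) (tagged t))).
  by apply: eq_bigr => K _; rewrite ffunE -big_split.
rewrite sum_prod_slot; apply: eq_bigr => t _; rewrite /F /replace.
case: eqP => _; first by rewrite ffunE.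
rewrite (bigD1 (J (tag t) (tagged t))) //= eqxx mul1r big1 ?addr0 // => b.
by rewrite eq_sym => /negPf ->; rewrite mul0r.
Qed.

Hypothesis A_skew : forall s (a b : 'I_(n (tag s))), A a b = - A b a.

Lemma kronecker_coef_skew J K : kronecker_coef J K = - kronecker_coef K J.
Proof.
rewrite /kronecker_coef -sumrN; apply: eq_bigr => s _.
rewrite (bigD1 s) //= [in RHS](bigD1 s) //= !eqxx A_skew mulNr.
congr (- (_ * _)); apply: eq_bigr => t /negPf ->; by rewrite eq_sym.
Qed.

Lemma kronecker_act_skew x y : dot (kronecker_act x) y = - dot x (kronecker_act y).
Proof.
rewrite /dot -sumrN.
under eq_bigr do rewrite ffunE big_distrl /=.
under [RHS]eq_bigr do rewrite ffunE mulr_sumr -sumrN.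
rewrite exchange_big; apply: eq_bigr => J _; apply: eq_bigr => K _.
by rewrite kronecker_coef_skew /=; ring.
Qed.

Lemma dot_kronecker_act x : dot (kronecker_act x) x = 0.
Proof. by have := kronecker_act_skew x x; rewrite dotC; lra. Qed.

End KroneckerSum.

Lemma segre_elementary (p : pre_point R n) :
  segre k p = p.1 *: elementary (block_family p.2).
Proof.
congr (_ *: _); apply/ffunP => J; rewrite !ffunE big_slot.
by apply: eq_bigr => i _; rewrite ffunE.
Qed.

(** Expanding [nu] in block i gives one term per position in that block, so the double sum is a sum
    over slots. *)
Lemma tangent_expr_elementary (p dp : pre_point R n) :
  tangent_expr k p dp = dp.1 *: elementary (block_family p.2) +
    p.1 *: elementary_diff (block_family p.2) (block_family dp.2).
Proof.
congr (_ *: _ + _ *: _).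
  apply/ffunP => J; rewrite !ffunE big_slot.
  by apply: eq_bigr => i _; rewrite ffunE.
rewrite /elementary_diff big_slot; apply: eq_bigr => i _.
apply/ffunP => J; rewrite ffunE (bigD1 i) //= eqxx /nu sum_ffunE big_distrl /=.
rewrite sum_ffunE; apply: eq_bigr => j _.
rewrite !ffunE big_slot /= [RHS](bigD1 i) //=; congr (_ * _).
  apply: eq_bigr => l _; rewrite /replace eq_Tagged.
  by rewrite /block_family /=; case: ifP.
apply: eq_bigr => i' ii'; rewrite (negPf ii') ffunE.
apply: eq_bigr => l _; rewrite /replace /block_family.
by case: eqP => // /(congr1 tag) /= e; rewrite e eqxx in ii'.
Qed.

End Tensors.

(** * Derivatives of curves *)

Section ScalarDerivatives.
Context {R : realType}.
Implicit Types (f g : R -> R) (t a b : R).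

Lemma derD f g t a b : is_derive t 1 f a -> is_derive t 1 g b ->
  is_derive t 1 (fun s => f s + g s) (a + b).
Proof. by move=> ? ?; exact: is_deriveD. Qed.

Lemma derB f g t a b : is_derive t 1 f a -> is_derive t 1 g b ->
  is_derive t 1 (fun s => f s - g s) (a - b).
Proof. by move=> ? ?; exact: is_deriveB. Qed.

Lemma derM f g t a b : is_derive t 1 f a -> is_derive t 1 g b ->
  is_derive t 1 (fun s => f s * g s) (a * g t + f t * b).
Proof.
move=> fa gb; apply: (@is_derive_eq _ _ _ _ _ _ _ _ (is_deriveM fa gb)).
by rewrite addrC /GRing.scale /= (mulrC a).
Qed.

Lemma derV f t a : f t != 0 -> is_derive t 1 f a ->
  is_derive t 1 (fun s => (f s)^-1) (- a / f t ^+ 2).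
Proof.
move=> ft fa; apply: (@is_derive_eq _ _ _ _ _ _ _ _ (is_deriveV ft fa)).
by rewrite /GRing.scale /= !mulNr mulrC.
Qed.

Lemma der_cst t a : is_derive t 1 (fun _ : R => a) 0.
Proof. exact: is_derive_cst. Qed.

Lemma der_id t : is_derive t 1 (fun s : R => s) 1.
Proof. exact: is_derive_id. Qed.

Lemma derZ f t a b : is_derive t 1 f a -> is_derive t 1 (fun s => b * f s) (b * a).
Proof.
move=> fa; apply: is_derive_eq (derM (der_cst t b) fa) _.
by rewrite mul0r add0r.
Qed.

Lemma der_comp f g t a b : is_derive (g t) 1 f a -> is_derive t 1 g b ->
  is_derive t 1 (fun s => f (g s)) (a * b).
Proof. by move=> ? ?; exact: is_derive1_comp. Qed.

Lemma der_sum (I : finType) (f : I -> R -> R) (a : I -> R) t :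
  (forall i, is_derive t 1 (f i) (a i)) ->
  is_derive t 1 (fun s => \sum_i f i s) (\sum_i a i).
Proof.
move=> fa; have -> : (fun s => \sum_i f i s) = \sum_i f i.
  by apply/funext => s; rewrite fct_sumE.
elim/big_ind2 : _ => [|f1 a1 f2 a2 h1 h2|i _]; [|exact: is_deriveD|exact: fa].
exact: is_derive_cst.
Qed.

Lemma der_prod (I : finType) (f : I -> R -> R) (a : I -> R) t :
  (forall i, is_derive t 1 (f i) (a i)) ->
  is_derive t 1 (fun s => \prod_i f i s)
    (\sum_i a i * \prod_(j | j != i) f j t).
Proof.
move=> fa.
(* Without repetitions the filter [j != i] removes exactly the head i of the list, which makes the
   induction go through. *)
suff H (r : seq I) : uniq r -> is_derive t 1 (fun s => \prod_(i <- r) f i s)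
    (\sum_(i <- r) a i * \prod_(j <- r | j != i) f j t).
  exact/H/index_enum_uniq.
elim: r => [_|i r IH /= /andP[ir ur]].
  rewrite big_nil; under [fun s => _]funext do rewrite big_nil.
  exact: der_cst.
under [fun s => _]funext do rewrite big_cons.
apply: is_derive_eq (derM (fa i) (IH ur)) _.
rewrite [RHS]big_cons big_cons eqxx /=; congr (_ * _ + _).
  rewrite big_seq [in RHS]big_seq_cond; apply: eq_bigl => j.
  by case jr : (j \in r) => //=; case: eqP => // ji; rewrite -ji jr in ir.
rewrite mulr_sumr; apply: eq_big_seq => j jr.
rewrite big_cons; case: eqP => [ij|_]; first by rewrite ij jr in ir.
by rewrite mulrCA.
Qed.

Lemma near_itvoo (a b t : R) : a < t < b -> \forall s \near t, a < s < b.
Proof.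
move=> tab; have : t \in `]a, b[ by rewrite in_itv.
by move=> /near_in_itvoo; apply: filterS => s; rewrite in_itv.
Qed.

Lemma der0_cst (a b : R) (f : R -> R) :
  (forall t, a < t < b -> is_derive t 1 f 0) ->
  forall s t, a < s < b -> a < t < b -> f s = f t.
Proof.
move=> df.
suff H s t : a < s < b -> a < t < b -> s < t -> f s = f t.
  move=> s t sab tab; have [/H ->//|/H ->//|->//] := ltgtP s t.
move=> /andP[as_ sb] /andP[at_ tb] st.
have df' x : x \in `]s, t[ -> is_derive x 1 f 0.
  by rewrite in_itv /= => /andP[sx xt]; apply: df; rewrite (lt_trans as_)//(lt_trans xt).
have [|c _] := MVT st df'; last by rewrite mul0r => /subr0_eq ->.
apply: derivable_within_continuous => x; rewrite in_itv /= => /andP[sx xt].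
by apply: ex_derive; apply: df; rewrite (lt_le_trans as_)//(le_lt_trans xt).
Qed.

End ScalarDerivatives.

Section Velocity.
Context {R : realType} {I : finType}.
Implicit Types (c : R -> array R I) (v x : array R I) (t : R).

(** Differentiability and the value of the derivative in one relation, so that the rules of calculus
    compose without side goals. *)
Definition has_velocity c t v : Prop :=
  forall i, is_derive t 1 (fun s => c s i) (v i).

Lemma has_velocityP c t v :
  has_velocity c t v <-> curve_derivable c t /\ velocity c t = v.
Proof.
split=> [h|[h <-] i].
  split=> [i|]; first by have [] := h i.
  by apply/ffunP => i; rewrite ffunE derive1E; have [] := h i.
by apply: DeriveDef; [exact: h|rewrite ffunE derive1E].
Qed.

Lemma has_velocity_near c1 c2 t v : (\forall s \near t, c1 s = c2 s) ->
  has_velocity c1 t v -> has_velocity c2 t v.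
Proof.
move=> e h i; apply: near_eq_is_derive (h i).
by apply: filterS e => s ->.
Qed.

Lemma has_velocity_uniq c t v w : has_velocity c t v -> has_velocity c t w -> v = w.
Proof. by move=> /has_velocityP[_ <-] /has_velocityP[_ <-]. Qed.

Lemma has_velocity_cst x t : has_velocity (fun=> x) t 0.
Proof. by move=> i; rewrite ffunE; exact: der_cst. Qed.

Lemma has_velocityD c1 c2 t v1 v2 : has_velocity c1 t v1 -> has_velocity c2 t v2 ->
  has_velocity (fun s => c1 s + c2 s) t (v1 + v2).
Proof.
move=> h1 h2 i; rewrite ffunE; under [fun s => _]funext do rewrite ffunE.
exact: derD.
Qed.

Lemma has_velocityZ (f : R -> R) c t (a : R) v :
  is_derive t 1 f a -> has_velocity c t v ->
  has_velocity (fun s => f s *: c s) t (a *: c t + f t *: v).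
Proof.
move=> fa h i; rewrite !ffunE; under [fun s => _]funext do rewrite ffunE.
exact: derM.
Qed.

Lemma has_velocityB c1 c2 t v1 v2 : has_velocity c1 t v1 -> has_velocity c2 t v2 ->
  has_velocity (fun s => c1 s - c2 s) t (v1 - v2).
Proof.
move=> h1 h2 i; rewrite !ffunE; under [fun s => _]funext do rewrite !ffunE.
exact: derB.
Qed.

Lemma has_velocity_sum (J : finType) (c : J -> R -> array R I) t (v : J -> array R I) :
  (forall j, has_velocity (c j) t (v j)) ->
  has_velocity (fun s => \sum_j c j s) t (\sum_j v j).
Proof.
move=> h i; rewrite sum_ffunE; under [fun s => _]funext do rewrite sum_ffunE.
by apply: der_sum => j; exact: h.
Qed.

Lemma der_dot c1 c2 t v1 v2 : has_velocity c1 t v1 -> has_velocity c2 t v2 ->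
  is_derive t 1 (fun s => dot (c1 s) (c2 s)) (dot v1 (c2 t) + dot (c1 t) v2).
Proof.
move=> h1 h2; rewrite /dot -big_split /=.
by apply: der_sum => i; exact: derM.
Qed.

Lemma der_dotr c x t v : has_velocity c t v ->
  is_derive t 1 (fun s => dot (c s) x) (dot v x).
Proof.
move=> h; apply: is_derive_eq (der_dot h (has_velocity_cst x t)) _.
by rewrite [dot _ 0]dotC dot0l addr0.
Qed.

Lemma has_velocity_line x v t : has_velocity (fun s => x + s *: v) t v.
Proof.
have := has_velocityD (has_velocity_cst x t)
  (has_velocityZ (der_id t) (has_velocity_cst v t)).
by rewrite scaler0 addr0 scale1r add0r.
Qed.

Lemma has_velocity_shift c t v :
  has_velocity c t v -> has_velocity (fun s => c (t + s)) 0 v.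
Proof.
move=> h i; have := h i; rewrite -{1}[t]addr0 => hi.
apply: is_derive_eq (der_comp hi (derD (der_cst 0 t) (der_id 0))) _.
by rewrite add0r mulr1.
Qed.

End Velocity.

Section TensorVelocity.
Context {R : realType} {d : nat} (n k : 'I_d -> nat).

Lemma has_velocity_elementary (v : R -> slot_family R n k)
    (w : slot_family R n k) (t : R) :
  (forall s, has_velocity (v^~ s) t (w s)) ->
  has_velocity (fun r => elementary (v r)) t (elementary_diff (v t) w).
Proof.
move=> h J; rewrite sum_ffunE; under [fun s => _]funext do rewrite ffunE.
apply: is_derive_eq (der_prod (fun s => h s (J (tag s) (tagged s)))) _.
apply: eq_bigr => s _; rewrite ffunE.
rewrite -(prod_replace s (fun r => w r (J (tag r) (tagged r)))
  (fun r => v t r (J (tag r) (tagged r)))).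
by apply: eq_bigr => r _; rewrite /replace; case: eqP.
Qed.

Lemma has_velocity_kronecker_act A (c : R -> tensor R n k) t v :
  has_velocity c t v ->
  has_velocity (fun s => kronecker_act A (c s)) t (kronecker_act A v).
Proof.
move=> h J; rewrite ffunE; under [fun s => _]funext do rewrite ffunE.
by apply: der_sum => K; apply: derZ.
Qed.

End TensorVelocity.

(** * The warped metric *)

Section NearDerivable.
Context {R : realType}.
Implicit Types (f : R -> R) (t a b : R).

Lemma is_derive_uniq f t a b : is_derive t 1 f a -> is_derive t 1 f b -> a = b.
Proof. by move=> [_ <-] [_ <-]. Qed.

Lemma is_derive_continuous f t a : is_derive t 1 f a -> {for t, continuous f}.
Proof. by case=> /derivable1_diffP /differentiable_continuous. Qed.

Lemma near_gt0 f t a : is_derive t 1 f a -> 0 < f t -> \forall s \near t, 0 < f s.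
Proof. by move=> /is_derive_continuous fc ft; exact: cvgr_gt fc _ ft. Qed.

End NearDerivable.

Section WarpedMetric.
Context {R : realType} {I : finType} (alpha : R).
Implicit Types x v w z : array R I.

(** Components along x count with weight 1 and those orthogonal to x with weight [alpha ^+ 2]. This
    rational expression in inner products, free of square roots, is the form that is differentiated
    in x. *)
Lemma warped_metricE x v w : dot x x != 0 ->
  warped_metric alpha x v w = alpha ^+ 2 * dot v w +
    (1 - alpha ^+ 2) * (dot v x * dot w x / dot x x).
Proof.
rewrite -sqr_enorm sqrf_eq0 => x0.
rewrite /warped_metric /angular /radial /direction.
rewrite !(dotZl, dotZr, dotBl, dotBr) -[dot x x]sqr_enorm (dotC x w).
by field.
Qed.

Lemma dir_derive_warped x v w z : dot x x != 0 ->
  dir_derive (fun y => warped_metric alpha y w z) x v = (1 - alpha ^+ 2) *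
    ((dot w v * dot z x + dot w x * dot z v) / dot x x
     - 2 * dot w x * dot z x * dot v x / dot x x ^+ 2).
Proof.
move=> x0; rewrite /dir_derive derive1E.
have dx : has_velocity (fun s : R => x + s *: v) 0 v by exact: has_velocity_line.
have dd := der_dot dx dx.
have xE : x + (0 : R) *: v = x by rewrite scale0r addr0.
have dw y : is_derive (0 : R) 1 (fun s => dot y (x + s *: v)) (dot y v).
  by have := der_dotr y dx; under [fun s => _]funext do rewrite dotC; rewrite dotC.
have xp : 0 < dot (x + (0 : R) *: v) (x + (0 : R) *: v).
  by rewrite xE lt_neqAle eq_sym x0 dot_ge0.
(* The rational formula holds only where [x + s *: v] is nonzero, hence the comparison for s near
   0. *)
apply: (@derive_val _ _ _ _ _ _ _ (near_eq_is_derive _ _)); last first.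
  apply: is_derive_eq (derD (der_cst 0 (alpha ^+ 2 * dot w z))
    (derZ (1 - alpha ^+ 2) (derM (derM (dw w) (dw z)) (derV (lt0r_neq0 xp) dd)))) _.
  by rewrite !xE (dotC x v); field.
have := near_gt0 dd xp; apply: filterS => s sp.
by rewrite warped_metricE ?lt0r_neq0.
Qed.

Lemma christoffel_warped x v z : dot x x != 0 ->
  christoffel (warped_metric alpha) x v v z = (1 - alpha ^+ 2) *
    (dot z x / dot x x * (dot v v - dot v x ^+ 2 / dot x x)).
Proof.
by move=> x0; rewrite /christoffel !dir_derive_warped // (dotC z v); field.
Qed.

(** The correction to the flat acceleration is radial, as it sees z only through [dot z (c t)], and
    it vanishes in the Euclidean case [alpha = 1]. *)
Lemma cov_acceleration_warped (c : R -> array R I) t v a z :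
  dot (c t) (c t) != 0 -> velocity c t = v -> velocity (velocity c) t = a ->
  cov_acceleration (warped_metric alpha) c t z =
    alpha ^+ 2 * dot a z + (1 - alpha ^+ 2) * (dot z (c t) / dot (c t) (c t) *
    (dot a (c t) + dot v v - dot v (c t) ^+ 2 / dot (c t) (c t))).
Proof.
move=> c0 cv ca; rewrite /cov_acceleration cv ca warped_metricE //.
by rewrite christoffel_warped //; field.
Qed.

End WarpedMetric.

(** * Tangent vectors of the Segre-Veronese cone *)

Section SegreVeronese.
Context {R : realType} {d : nat} (n k : 'I_d -> nat).
Implicit Types (p dp : pre_point R n) (x v : tensor R n k).

Lemma elementaryZ (f : slot k -> R) (v : slot_family R n k) :
  elementary (fun s => f s *: v s) = (\prod_s f s) *: elementary v.
Proof.
apply/ffunP => J; rewrite !ffunE /GRing.scale /= -big_split.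
by apply: eq_bigr => s _; rewrite ffunE.
Qed.

Lemma pre_unit p : pre_segre_veronese p ->
  forall s : slot k, dot (block_family p.2 s) (block_family p.2 s) = 1.
Proof. by move=> [_ p1] s; apply/enorm_unit. Qed.

Lemma pre_tangent_slot p dp : pre_tangent p dp ->
  forall s : slot k, dot (block_family dp.2 s) (block_family p.2 s) = 0.
Proof. by move=> h s; rewrite dotC; exact: h. Qed.

(** Normalising the factors moves their norms, once per slot, into the positive scalar. *)
Lemma segre_veronese_elementary (a : R) (y : forall i, vec R (n i)) :
  0 < a -> (forall i, y i != 0) ->
  segre_veronese (a *: elementary (block_family y) : tensor R n k).
Proof.
move=> a0 y0.
have yp i : 0 < enorm (y i).
  rewrite lt_neqAle enorm_ge0 andbT eq_sym; apply: contraNneq (y0 i) => e.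
  by apply/eqP/dot_eq0; rewrite -sqr_enorm e expr0n.
exists (a * \prod_(s : slot k) enorm (y (tag s)), fun i => (enorm (y i))^-1 *: y i).
  split=> /= [|i]; first by rewrite mulr_gt0// prodr_gt0.
  by rewrite enormZ ger0_norm ?invr_ge0 ?enorm_ge0// mulVf ?lt0r_neq0.
rewrite segre_elementary /= /block_family.
rewrite (elementaryZ (fun s : slot k => (enorm (y (tag s)))^-1)) scalerA.
rewrite prodfV mulfK //; apply/prodf_neq0 => s _.
by rewrite lt0r_neq0.
Qed.

(** The scalar and all factors move along straight lines. The factors stay nonzero because their
    component along the unit vector [p.2 i] remains 1. *)
Lemma tangent_expr_tangent p dp : pre_segre_veronese p -> pre_tangent p dp ->
  tangent_space (@segre_veronese R d n k) (segre k p) (tangent_expr k p dp).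
Proof.
move=> hp hdp.
pose y r i := p.2 i + r *: dp.2 i.
have y0 : y 0 = p.2.
  by apply/functional_extensionality_dep => i; rewrite /y scale0r addr0.
exists (fun r => (p.1 + r * dp.1) *: elementary (block_family (y r))).
have df : is_derive (0 : R) 1 (fun r => p.1 + r * dp.1) dp.1.
  apply: is_derive_eq (derD (der_cst 0 p.1) (derM (der_id 0) (der_cst 0 dp.1))) _.
  ring.
have de : has_velocity (fun r => (p.1 + r * dp.1) *: elementary (block_family (y r)))
    0 (tangent_expr k p dp).
  have h : forall s : slot k, has_velocity (fun r => block_family (y r) s) 0
      (block_family dp.2 s).
    by move=> s; exact: has_velocity_line.
  have := has_velocityZ df (has_velocity_elementary h).
  by rewrite y0 mul0r addr0 tangent_expr_elementary.
have [dc dv] := (has_velocityP _ _ _).1 de.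
split=> //; last by rewrite y0 mul0r addr0 segre_elementary.
have [p0 p1] := hp.
have := near_gt0 df; rewrite mul0r addr0 => /(_ p0); apply: filterS => r r0.
apply: segre_veronese_elementary => // i; apply/eqP => yi.
have : dot (y r i) (p.2 i) = 1.
  by rewrite dotDl dotZl (dotC (dp.2 i)) hdp mulr0 addr0; apply/enorm_unit.
by rewrite yi dot0l => /esym/eqP; rewrite oner_eq0.
Qed.

(** Pairing with the elementary tensor of p recovers the radial coefficient. Pairing with the
    differential along the difference w of the two lifts then gives that the sum of the [k i] times
    the squared norms of the [w i] is 0. *)
Lemma lifted_tangent_uniq (hk : forall i, (0 < k i)%N) p v dp dp' :
  pre_segre_veronese p -> lifted_tangent p v dp -> lifted_tangent p v dp' -> dp = dp'.
Proof.
move=> hp [t1 ->] [t2].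
have u1 := pre_unit hp.
have e1 := pre_tangent_slot t1; have e2 := pre_tangent_slot t2.
rewrite !tangent_expr_elementary => e.
have m : dp.1 = dp'.1.
  have := congr1 (fun x => dot x (elementary (block_family p.2))) e.
  by rewrite /= !dotDl !dotZl dot_elementary_unit // !dot_diff_unit // !mulr0 !mulr1 !addr0.
pose w i : vec R (n i) := dp.2 i - dp'.2 i.
have e3 (s : slot k) : dot (block_family w s) (block_family p.2 s) = 0 :> R.
  by rewrite dotBl e1 e2 subr0.
have : \sum_(s : slot k) dot (w (tag s)) (w (tag s)) = 0.
  have := congr1 (fun x => dot x (elementary_diff (block_family p.2) (block_family w))) e.
  rewrite /= !dotDl !dotZl !(dotC (elementary _)) !dot_diff_unit // !mulr0 !add0r.
  rewrite !dot_diff2 // => /(mulfI (lt0r_neq0 hp.1)) h.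
  transitivity (\sum_(s : slot k) dot (block_family dp.2 s) (block_family w s) -
      \sum_(s : slot k) dot (block_family dp'.2 s) (block_family w s)).
    by rewrite -sumrB; apply: eq_bigr => s _; rewrite -dotBl.
  by rewrite h subrr.
rewrite (sum_slot_tag k (fun i => dot (w i) (w i))) => /eqP.
rewrite psumr_eq0 => [/allP h|i _]; last by rewrite mulr_ge0 ?dot_ge0.
have w0 i : dp.2 i = dp'.2 i.
  have := h i; rewrite mem_index_enum => /(_ isT).
  rewrite mulf_eq0 pnatr_eq0 eqn0Ngt hk /= => /eqP /dot_eq0 /eqP.
  by rewrite subr_eq0 => /eqP.
case: dp dp' m w0 {t1 t2 e1 e2 e3 e w h} => [a f] [b g] /= -> w0.
by congr pair; apply/functional_extensionality_dep.
Qed.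

(* A curve c in the cone is F(t) times the elementary tensor with factors
   y_i(t), where F is the pairing of c with U = segre p / lambda, and y_i is the
   contraction of c with U in all slots but one of block i, divided by F. Both
   are differentiable since they are obtained linearly from c. *)
Lemma tangent_lift (hk : forall i, (0 < k i)%N) p v : pre_segre_veronese p ->
  tangent_space (@segre_veronese R d n k) (segre k p) v ->
  exists dp, lifted_tangent p v dp.
Proof.
move=> hp [c [nearS dc c0 vc]].
have cv : has_velocity c 0 v by apply/has_velocityP.
have u1 := pre_unit hp; have [p0 p1] := hp.
pose u := block_family (k := k) p.2.
pose U := elementary u.
pose F s := dot (c s) U.
have F0 : F 0 = p.1.
  by rewrite /F c0 segre_elementary dotZl dot_elementary_unit // mulr1.
have dF : is_derive (0 : R) 1 F (dot v U) by exact: der_dotr.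
pose e i (b : 'I_(n i)) : vec R (n i) := [ffun a => (a == b)%:R : R^o].
(* Pairing with [W i b] contracts all slots with u except the first slot of block i, present because
   [0 < k i], where it reads coordinate b. [dfwith] extends [e i b] to a dependent family. *)
pose W i b := elementary (replace (Tagged (fun i => 'I_(k i)) (Ordinal (hk i)))
  (block_family (eqtype.dfwith (fun j => 0 : vec R (n j)) (e i b))) u).
pose y s : forall i, vec R (n i) := fun i => [ffun b => dot (c s) (W i b) * (F s)^-1].
pose w i : vec R (n i) := [ffun b =>
  dot v (W i b) * (F 0)^-1 + dot (c 0) (W i b) * (- dot v U / F 0 ^+ 2)].
have Fn0 : F 0 != 0 by rewrite F0 lt0r_neq0.
have dy i : has_velocity (y^~ i) 0 (w i).
  move=> b; rewrite ffunE; under [fun s => _]funext do rewrite ffunE.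
  by apply: derM; [exact: der_dotr|exact: derV].
(* Whatever factors z represent [c s], the contractions return them rescaled to have inner product 1
   with [p.2 i]. No differentiable choice of representatives has to be made. *)
have key s (z : forall i, vec R (n i)) (l : R) : c s = l *: elementary (block_family z) ->
    F s != 0 -> (forall i, y s i = (dot (z i) (p.2 i))^-1 *: z i)
      /\ (forall i, dot (z i) (p.2 i) != 0).
  move=> cs; rewrite /F cs dotZl dot_elementary => Fs.
  have nz (t : slot k) : dot (block_family z t) (u t) != 0.
    by apply: contraNneq Fs => h; rewrite (bigD1 t) //= h mul0r mulr0.
  have nzi i : dot (z i) (p.2 i) != 0.
    exact: nz (Tagged (fun i => 'I_(k i)) (Ordinal (hk i))).
  split=> // i; apply/ffunP => b; rewrite !ffunE.
  set s0 := Tagged (fun i => 'I_(k i)) (Ordinal (hk i)).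
  have zb : dot (block_family (eqtype.dfwith (fun j => 0 : vec R (n j)) (e i b)) s0)
     (block_family z s0) = z i b.
    rewrite /block_family /= dfwith_in /dot (bigD1 b) //= ffunE eqxx mul1r.
    by rewrite big1 ?addr0 // => a /negPf ab; rewrite ffunE ab mul0r.
  have -> : dot (c s) (W i b) = l * (z i b * \prod_(t | t != s0) dot (block_family z t) (u t)).
    rewrite cs dotZl dotC /W dot_replacel zb; congr (_ * (_ * _)).
    by apply: eq_bigr => t _; rewrite dotC.
  rewrite /F cs dotZl dot_elementary.
  move: Fs; rewrite (bigD1 s0) //= !mulf_eq0 !negb_or => /andP[l0 /andP[a0 P0]].
  have <- : dot (block_family z s0) (u s0) = dot (z i) (p.2 i) by [].
  rewrite /GRing.scale /=.
  by field; rewrite l0 a0 P0.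
have nearF : \forall s \near (0 : R), F s != 0.
  by have := near_gt0 dF; rewrite F0 => /(_ p0); apply: filterS => s /lt0r_neq0.
have nearc : \forall s \near (0 : R), F s *: elementary (block_family (y s)) = c s.
  near=> s; have [q [q0 q1]] : segre_veronese (c s) by near: s.
  rewrite segre_elementary => /esym cs.
  have Fs : F s != 0 by near: s.
  have [ye nz] := key _ _ _ cs Fs.
  have -> : block_family (y s) = fun t : slot k => (dot (q.2 (tag t)) (p.2 (tag t)))^-1
      *: block_family q.2 t.
    by apply/functional_extensionality_dep => t; rewrite /block_family ye.
  rewrite (elementaryZ (fun t : slot k => (dot (q.2 (tag t)) (p.2 (tag t)))^-1)).
  rewrite scalerA /F cs dotZl dot_elementary prodfV; congr (_ *: _).
  by rewrite mulfK //; apply/prodf_neq0 => t _; exact: nz.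
(* Differentiating this constant shows that [w i] is orthogonal to [p.2 i]. *)
have neary i : \forall s \near (0 : R), dot (y s i) (p.2 i) = 1.
  near=> s; have [q [q0 q1]] : segre_veronese (c s) by near: s.
  rewrite segre_elementary => /esym cs.
  have Fs : F s != 0 by near: s.
  have [ye nz] := key _ _ _ cs Fs.
  by rewrite ye dotZl mulVf.
have y0 : y 0 = p.2.
  apply/functional_extensionality_dep => i.
  have cs : c 0 = p.1 *: elementary (block_family p.2) by rewrite c0 segre_elementary.
  have [-> _] := key _ _ _ cs Fn0.
  by rewrite ((enorm_unit _).1 (p1 i)) invr1 scale1r.
exists (dot v U, w); split=> [i /=|].
  rewrite dotC; apply: is_derive_uniq (der_dotr (p.2 i) (dy i)) _.
  apply: near_eq_is_derive (der_cst 0 1).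
  by apply: filterS (neary i) => s ->.
have dyb (t : slot k) : has_velocity (fun s => block_family (y s) t) 0 (block_family w t).
  exact: dy.
have := has_velocity_near nearc (has_velocityZ dF (has_velocity_elementary dyb)).
move=> /(has_velocity_uniq cv) vE.
by rewrite tangent_expr_elementary [LHS]vE F0 y0.
Unshelve. all: by end_near.
Qed.

End SegreVeronese.

(** * Uniqueness of geodesics *)

Section Uniqueness.
Context {R : realType} {d : nat} (n k : 'I_d -> nat).
Implicit Types (p dp : pre_point R n) (x v z : tensor R n k).

Lemma elementary_diffZ (u w : slot_family R n k) (a : R) :
  elementary_diff u (fun s => a *: w s) = a *: elementary_diff u w.
Proof.
rewrite /elementary_diff scaler_sumr; apply: eq_bigr => s _.
have -> : replace s (fun s => a *: w s) u =
    fun t => (if t == s then a else 1) *: replace s w u t.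
  apply/functional_extensionality_dep => t; rewrite /replace.
  by case: eqP => _; rewrite ?scale1r.
rewrite (elementaryZ (fun t => if t == s then a else 1)); congr (_ *: _).
by rewrite (prod_replace s (fun=> a) (fun=> 1)) big1 ?mulr1.
Qed.

Definition block_matrix : Type := forall i, 'I_(n i) -> 'I_(n i) -> R.

Definition block_skew (A : block_matrix) : Prop :=
  forall i a b, A i a b = - A i b a.

Definition block_act (A : block_matrix) (u : forall i, vec R (n i)) : forall i, vec R (n i) :=
  fun i => [ffun a => \sum_b A i a b * u i b].

Lemma dot_block_act (A : block_matrix) i (u w : forall i, vec R (n i)) :
  dot (w i) (block_act A u i) = \sum_a \sum_b A i a b * (w i a * u i b).
Proof.
apply: eq_bigr => a _; rewrite ffunE mulr_sumr.
by apply: eq_bigr => b _; rewrite mulrCA.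
Qed.

(** A skew matrix sees only the antisymmetric part of [w i a * u i b]; this is how momenta arise. *)
Lemma dot_block_act_skew (A : block_matrix) i (u w : forall i, vec R (n i)) :
  block_skew A ->
  dot (w i) (block_act A u i) =
  2^-1 * \sum_a \sum_b A i a b * (w i a * u i b - u i a * w i b).
Proof.
move=> Askew; rewrite dot_block_act.
set X := \sum_a _.
have -> : \sum_a \sum_b A i a b * (w i a * u i b - u i a * w i b) = X + X.
  rewrite {2}/X [X in _ + X]exchange_big -big_split; apply: eq_bigr => a _.
  rewrite -big_split; apply: eq_bigr => b _ /=.
  by rewrite [in RHS](Askew i b a); ring.
by field.
Qed.

Lemma segre_act (A : block_matrix) p :
  kronecker_act (fun s : slot k => A (tag s)) (segre k p) =
  p.1 *: elementary_diff (block_family p.2) (block_family (block_act A p.2)).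
Proof. by rewrite segre_elementary kronecker_actZ kronecker_act_elementary. Qed.

Lemma tangent_radial p : pre_segre_veronese p ->
  tangent_space (@segre_veronese R d n k) (segre k p) (segre k p).
Proof.
move=> hp; have e : tangent_expr k p (p.1, fun=> 0) = segre k p.
  rewrite tangent_expr_elementary segre_elementary /=.
  have -> : block_family (fun i => 0 : vec R (n i)) =
      fun s : slot k => 0 *: (0 : vec R (n (tag s))).
    by apply/functional_extensionality_dep => s; rewrite scale0r.
  by rewrite elementary_diffZ scale0r scaler0 addr0.
by rewrite -{2}e; apply: tangent_expr_tangent => // i; rewrite dotC dot0l.
Qed.

(** The lift is [(0, block_act A p.2)]: a skew matrix sends a vector to one orthogonal to it. *)
Lemma tangent_act (A : block_matrix) p : pre_segre_veronese p ->
  block_skew A ->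
  tangent_space (@segre_veronese R d n k) (segre k p)
    (kronecker_act (fun s : slot k => A (tag s)) (segre k p)).
Proof.
move=> hp Askew; rewrite segre_act.
have -> : p.1 *: elementary_diff (block_family p.2) (block_family (block_act A p.2)) =
    tangent_expr k p (0, block_act A p.2).
  by rewrite tangent_expr_elementary /= scale0r add0r.
apply: tangent_expr_tangent => // i /=; rewrite dot_block_act_skew //.
by rewrite big1 ?mulr0// => a _; rewrite big1 // => b _; rewrite subrr mulr0.
Qed.

(* |c1 - c2|^2 / rho is constant, since the action of A is skew. *)
Lemma linear_ode_uniq A (c1 c2 : R -> tensor R n k) (h rho : R -> R) (a b : R) :
  (forall (s : slot k) (x y : 'I_(n (tag s))), A s x y = - A s y x) ->
  (forall t, a < t < b -> 0 < rho t /\ is_derive t 1 rho (2 * h t)) ->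
  (forall t, a < t < b -> has_velocity c1 t
    (h t / rho t *: c1 t + (rho t)^-1 *: kronecker_act A (c1 t))) ->
  (forall t, a < t < b -> has_velocity c2 t
    (h t / rho t *: c2 t + (rho t)^-1 *: kronecker_act A (c2 t))) ->
  forall s t, a < s < b -> a < t < b -> c1 s = c2 s -> c1 t = c2 t.
Proof.
move=> Askew hrho h1 h2 s t sab tab cs.
pose D r := c1 r - c2 r.
pose q r := dot (D r) (D r) * (rho r)^-1.
have dq r : a < r < b -> is_derive r 1 q 0.
  move=> rab; have [rho0 drho] := hrho r rab.
  have dD := has_velocityB (h1 r rab) (h2 r rab).
  apply: is_derive_eq (derM (der_dot dD dD) (derV (lt0r_neq0 rho0) drho)) _.
  have -> : h r / rho r *: c1 r + (rho r)^-1 *: kronecker_act A (c1 r) -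
    (h r / rho r *: c2 r + (rho r)^-1 *: kronecker_act A (c2 r)) =
    h r / rho r *: D r + (rho r)^-1 *: kronecker_act A (D r).
    rewrite /D -[- c2 r]scaleN1r kronecker_actD kronecker_actZ !scalerDr.
    by rewrite !scalerA opprD !mulrN1 !scaleNr addrACA.
  rewrite -/(D r); move: (D r) => X.
  rewrite !(dotDl, dotZl, dotDr, dotZr) (dotC X (kronecker_act _ _)).
  by rewrite dot_kronecker_act //; field; rewrite lt0r_neq0.
have := der0_cst dq tab sab; rewrite /q {2 3}/D cs subrr dot0l mul0r => /eqP.
rewrite mulf_eq0 invr_eq0 (gt_eqF (hrho t tab).1) orbF => /eqP /dot_eq0.
exact: subr0_eq.
Qed.

(** The value [warped_metric alpha x v v] for nonzero x, in rational form. *)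
Definition energy (I : finType) (alpha : R) (x v : array R I) : R :=
  alpha ^+ 2 * dot v v + (1 - alpha ^+ 2) * (dot v x ^+ 2 / dot x x).

(** The angular momentum of the i-th factor, up to the constants [k i] and [alpha]. *)
Definition momentum p dp : block_matrix := fun i a b =>
  p.1 ^+ 2 * (dp.2 i a * p.2 i b - p.2 i a * dp.2 i b).

Arguments momentum : clear implicits.

Lemma momentum_skew p dp : block_skew (momentum p dp).
Proof. by move=> i a b; rewrite /momentum; ring. Qed.

Lemma dot_segre p : pre_segre_veronese p -> dot (segre k p) (segre k p) = p.1 ^+ 2.
Proof.
move=> hp; rewrite segre_elementary dotZl dotZr dot_elementary_unit ?mulr1 //.
exact: pre_unit.
Qed.

Lemma dot_tangent_segre p dp : pre_segre_veronese p -> pre_tangent p dp ->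
  dot (tangent_expr k p dp) (segre k p) = dp.1 * p.1.
Proof.
move=> hp hdp; have u1 := @pre_unit _ _ _ k _ hp.
have wu := @pre_tangent_slot _ _ _ k _ _ hdp.
rewrite tangent_expr_elementary segre_elementary dotZr dotDl !dotZl.
by rewrite dot_elementary_unit // dot_diff_unit //; ring.
Qed.

(** The Noether charge of A is a weighted Frobenius pairing of A with the momentum, so the charges
    for all skew A determine the momentum. *)
Lemma dot_tangent_act (A : block_matrix) p dp : pre_segre_veronese p -> pre_tangent p dp ->
  block_skew A ->
  dot (tangent_expr k p dp) (kronecker_act (fun s : slot k => A (tag s)) (segre k p)) =
  2^-1 * \sum_i (k i)%:R * \sum_a \sum_b A i a b * momentum p dp i a b.
Proof.
move=> hp hdp Askew; have u1 := @pre_unit _ _ _ k _ hp.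
have wu := @pre_tangent_slot _ _ _ k _ _ hdp.
have Au (s : slot k) : dot (block_family (block_act A p.2) s) (block_family p.2 s) = 0.
  rewrite dotC dot_block_act_skew ?big1 ?mulr0// => a _.
  by rewrite big1 // => b _; rewrite subrr mulr0.
rewrite tangent_expr_elementary segre_act dotZr dotDl !dotZl.
rewrite (dotC (elementary _)) dot_diff_unit // mulr0 add0r dot_diff2 //.
rewrite (sum_slot_tag k (fun i => dot (dp.2 i) (block_act A p.2 i))) !mulr_sumr.
apply: eq_bigr => i _; rewrite dot_block_act_skew // !mulr_sumr.
apply: eq_bigr => a _; rewrite !mulr_sumr; apply: eq_bigr => b _.
by rewrite /momentum; ring.
Qed.

(* Since the u_i are unit and dp.2 i is orthogonal to them, the momentum matrix
   sends u_i to lambda^2 dp.2 i. *)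
Lemma tangent_expr_momentum p dp : pre_segre_veronese p -> pre_tangent p dp ->
  tangent_expr k p dp = dp.1 / p.1 *: segre k p + (p.1 ^+ 2)^-1 *:
    kronecker_act (fun s : slot k => momentum p dp (tag s)) (segre k p).
Proof.
move=> hp hdp; have [p0 p1] := hp; have p0' := lt0r_neq0 p0.
rewrite (segre_act (momentum p dp)) tangent_expr_elementary segre_elementary !scalerA.
rewrite divfK //; congr (_ + _).
have -> : block_family (block_act (momentum p dp) p.2) =
    fun s : slot k => p.1 ^+ 2 *: block_family dp.2 s.
  apply/functional_extensionality_dep => s; apply/ffunP => a.
  rewrite !ffunE /block_family; set i := tag s.
  transitivity (p.1 ^+ 2 * (dp.2 i a * dot (p.2 i) (p.2 i) -
      p.2 i a * dot (p.2 i) (dp.2 i))).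
    rewrite /dot !mulr_sumr -sumrB mulr_sumr; apply: eq_bigr => b _.
    by rewrite /momentum; ring.
  by rewrite hdp (enorm_unit _).1 // mulr0 subr0 mulr1.
by rewrite elementary_diffZ scalerA; congr (_ *: _); field.
Qed.

(** * Conserved quantities of a geodesic *)

Section Geodesic.
Hypothesis hk : forall i, (0 < k i)%N.
Variables (alpha a b : R) (c : R -> tensor R n k).
Hypothesis alpha_gt0 : 0 < alpha.
Hypothesis geo :
  geodesic_on (@warped_metric R (tensor_index n k) alpha) (@segre_veronese R d n k) a b c.

Let v := velocity c.
Let acc := velocity v.
Let rho t := dot (c t) (c t).
Let h t := dot (v t) (c t).
(** The squared length of the component of the velocity orthogonal to [c t]. *)
Let K t := dot (v t) (v t) - h t ^+ 2 / rho t.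

Lemma geodesic_velocity t : a < t < b -> has_velocity c t (v t).
Proof. by move=> /geo[_ dc _ _]; apply/has_velocityP. Qed.

Lemma geodesic_acceleration t : a < t < b -> has_velocity v t (acc t).
Proof. by move=> /geo[_ _ dv _]; apply/has_velocityP. Qed.

Lemma geodesic_tangent t : a < t < b ->
  tangent_space (@segre_veronese R d n k) (c t) (v t).
Proof.
move=> tab; exists (fun s => c (t + s)).
have [dc cv] := (has_velocityP _ _ _).1 (has_velocity_shift (geodesic_velocity tab)).
split=> //; last by rewrite addr0.
have tabs : \forall s \near (0 : R), a < t + s < b.
  have := near_itvoo (a := a - t) (b := b - t) (t := 0).
  by rewrite subr_lt0 subr_gt0 => /(_ tab); apply: filterS => s /andP[? ?]; apply/andP; split; lra.
by apply: filterS tabs => s /geo[].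
Qed.

Lemma geodesic_lift t : a < t < b ->
  exists p dp, [/\ pre_segre_veronese p, pre_tangent p dp,
    c t = segre k p & v t = tangent_expr k p dp].
Proof.
move=> tab; have [[p hp pc] _ _ _] := geo tab.
have := geodesic_tangent tab; rewrite -pc => /(tangent_lift hk hp) [dp [h1 h2]].
by exists p, dp.
Qed.

Lemma geodesic_rho_gt0 t : a < t < b -> 0 < rho t.
Proof.
move=> /geodesic_lift[p [dp [hp _ ct _]]]; rewrite /rho ct dot_segre //.
by have [p0 _] := hp; rewrite exprn_gt0.
Qed.

(** The radial test vector [c t] determines [dot (acc t) (c t)]. Substituting this into the equation
    for z leaves a common factor [alpha ^+ 2], which is cancelled. *)
Lemma geodesic_acceleration_tangent t z : a < t < b ->
  tangent_space (@segre_veronese R d n k) (c t) z ->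
  dot (acc t) z = - (1 - alpha ^+ 2) * K t * dot z (c t) / rho t.
Proof.
move=> tab tz; have r0 := lt0r_neq0 (geodesic_rho_gt0 tab).
have a0 : alpha ^+ 2 != 0 by rewrite sqrf_eq0 lt0r_neq0.
have [p [dp [hp _ ct _]]] := geodesic_lift tab.
have [_ _ _ G] := geo tab.
have Gc : dot (acc t) (c t) = - (1 - alpha ^+ 2) * K t.
  have tc : tangent_space (@segre_veronese R d n k) (c t) (c t).
    by rewrite ct; exact: tangent_radial.
  have := G (c t) tc.
  rewrite (cov_acceleration_warped alpha _ r0 erefl erefl) divff // mul1r.
  by rewrite -/v -/acc -/(h t) -/(rho t) => e; rewrite /K; lra.
have := G z tz; rewrite (cov_acceleration_warped alpha _ r0 erefl erefl).
rewrite -/v -/acc -/(h t) -/(rho t) Gc => e.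
apply: (mulfI a0); move/eqP: e; rewrite addrC addr_eq0 => /eqP e.
rewrite -[LHS]opprK -e /K; field; exact: r0.
Qed.

Lemma der_rho t : a < t < b -> is_derive t 1 rho (2 * h t).
Proof.
move=> tab; have hv := geodesic_velocity tab.
apply: is_derive_eq (der_dot hv hv) _.
by rewrite (dotC (c t)) /h; ring.
Qed.

(** The product rule gives [dot (acc t) (c t) + dot (v t) (v t)], and the radial equation turns this
    into the energy. *)
Lemma der_h t : a < t < b -> is_derive t 1 h (energy alpha (c t) (v t)).
Proof.
move=> tab; have [p [dp [hp _ ct _]]] := geodesic_lift tab.
have r0 := lt0r_neq0 (geodesic_rho_gt0 tab).
apply: is_derive_eq (der_dot (geodesic_acceleration tab) (geodesic_velocity tab)) _.
rewrite (geodesic_acceleration_tangent tab); last by rewrite ct; exact: tangent_radial.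
by rewrite /energy /K -/(rho t) -/(h t); field.
Qed.

(** Here the test vector is the velocity, which is tangent to the cone. *)
Lemma geodesic_energy t : a < t < b ->
  is_derive t 1 (fun s => energy alpha (c s) (v s)) 0.
Proof.
move=> tab; have r0 := lt0r_neq0 (geodesic_rho_gt0 tab).
have ha := geodesic_acceleration tab.
have hh := der_h tab.
apply: is_derive_eq (derD (derZ (alpha ^+ 2) (der_dot ha ha))
  (derZ (1 - alpha ^+ 2) (derM (derM hh hh) (derV r0 (der_rho tab))))) _.
rewrite (dotC (v t) (acc t)) (geodesic_acceleration_tangent tab (geodesic_tangent tab)).
by rewrite /energy /K -/(rho t) -/(h t); field.
Qed.

Hypothesis ab0 : a < 0 < b.
Let E0 := energy alpha (c 0) (v 0).

Lemma geodesic_h t : a < t < b -> h t = E0 * t + h 0.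
Proof.
move=> tab.
have D s : a < s < b -> is_derive s 1 (fun r => h r - E0 * r) 0.
  move=> sab; apply: is_derive_eq (derB (der_h sab) (derZ E0 (der_id s))) _.
  by rewrite (der0_cst geodesic_energy sab ab0) /E0; ring.
by have := der0_cst D tab ab0; rewrite mulr0 subr0 => <-; ring.
Qed.

Lemma geodesic_rho t : a < t < b -> rho t = E0 * t ^+ 2 + 2 * h 0 * t + rho 0.
Proof.
move=> tab.
have D s : a < s < b -> is_derive s 1 (fun r => rho r - r * (E0 * r + 2 * h 0)) 0.
  move=> sab; apply: is_derive_eq (derB (der_rho sab) (derM (der_id s)
     (derD (derZ E0 (der_id s)) (der_cst s (2 * h 0))))) _.
  by rewrite (geodesic_h sab); ring.
by have := der0_cst D tab ab0; rewrite mul0r subr0 => <-; ring.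
Qed.

(** Of the two terms of the derivative, the one with the acceleration vanishes since X_A c is
    tangent and orthogonal to c, the other since X_A is skew. *)
Lemma geodesic_noether (A : block_matrix) t : block_skew A -> a < t < b ->
  dot (v t) (kronecker_act (fun s : slot k => A (tag s)) (c t)) =
  dot (v 0) (kronecker_act (fun s : slot k => A (tag s)) (c 0)).
Proof.
move=> Askew tab; set X := kronecker_act _.
apply: (@der0_cst _ a b (fun s => dot (v s) (X (c s)))) => // s sab.
have [p [dp [hp _ ct _]]] := geodesic_lift sab.
have hv := geodesic_velocity sab.
apply: is_derive_eq (der_dot (geodesic_acceleration sab)
  (has_velocity_kronecker_act (fun s : slot k => A (tag s)) hv)) _.
rewrite geodesic_acceleration_tangent //; last by rewrite /X ct; exact: tangent_act.
rewrite /X (dotC (v s)) !dot_kronecker_act; try by move=> *; apply: Askew.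
by rewrite mulr0 mul0r addr0.
Qed.

Variables p dp : pre_point R n.
Hypothesis (hp : pre_segre_veronese p) (hdp : pre_tangent p dp).
Hypothesis (c0 : c 0 = segre k p) (v0 : v 0 = tangent_expr k p dp).

(* Noether's identity is applied with A the difference of the two momenta. *)
Lemma geodesic_momentum t q dq : a < t < b ->
  pre_segre_veronese q -> pre_tangent q dq -> c t = segre k q ->
  v t = tangent_expr k q dq ->
  momentum q dq = momentum p dp.
Proof.
move=> tab hq hdq ct vt; apply/functional_extensionality_dep => i.
apply/funext => x; apply/funext => y.
pose A : block_matrix := fun j (x y : 'I_(n j)) => momentum q dq j x y - momentum p dp j x y.
have Askew : block_skew A.
  by move=> j x' y'; rewrite /A (momentum_skew q) (momentum_skew p); ring.
have := geodesic_noether Askew tab.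
rewrite vt v0 c0 ct !dot_tangent_act // => /(mulfI _) e.
(* Subtracting the two charges leaves the pairing of A with itself, a sum of squares with positive
   weights. *)
have {e} : \sum_j (k j)%:R * \sum_x \sum_y A j x y ^+ 2 = 0.
  rewrite -[RHS](subrr (\sum_i (k i)%:R * \sum_a \sum_b A i a b * momentum p dp i a b)).
  rewrite -[in X in _ = X - _]e ?invr_eq0 ?pnatr_eq0 // -sumrB.
  apply: eq_bigr => j _; rewrite -mulrBr -sumrB; congr (_ * _).
  apply: eq_bigr => x' _; rewrite -sumrB; apply: eq_bigr => y' _.
  by rewrite -mulrBr expr2.
have A2 j : 0 <= \sum_x \sum_y A j x y ^+ 2.
  by apply: sumr_ge0 => x' _; apply: sumr_ge0 => y' _; exact: sqr_ge0.
move=> /eqP; rewrite psumr_eq0 => [/allP e|j _]; last by rewrite mulr_ge0.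
have := e i; rewrite mem_index_enum => /(_ isT) /=.
rewrite mulf_eq0 pnatr_eq0 eqn0Ngt hk /=.
rewrite psumr_eq0 => [/allP {}e|x' _]; last by apply: sumr_ge0 => y' _; exact: sqr_ge0.
have := e x; rewrite mem_index_enum => /(_ isT) /=.
rewrite psumr_eq0 => [/allP {}e|y' _]; last exact: sqr_ge0.
have := e y; rewrite mem_index_enum => /(_ isT) /=.
by rewrite sqrf_eq0 subr_eq0 => /eqP.
Qed.

(** Any lift of the position and velocity at time t has the momentum of the initial lift, so the
    matrix of the equation is constant in time. *)
Lemma geodesic_ode t : a < t < b ->
  has_velocity c t (h t / rho t *: c t + (rho t)^-1 *:
    kronecker_act (fun s : slot k => momentum p dp (tag s)) (c t)).
Proof.
move=> tab; have [q [dq [hq hdq ct vt]]] := geodesic_lift tab.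
have := geodesic_velocity tab; rewrite [in X in X -> _]vt tangent_expr_momentum //.
rewrite (geodesic_momentum tab hq hdq ct vt).
have [/lt0r_neq0 q0 _] := hq.
rewrite /h /rho vt ct dot_tangent_segre // dot_segre //.
by congr (has_velocity _ _ (_ *: _ + _)); field.
Qed.

End Geodesic.

Lemma geodesic_uniq (hk : forall i, (0 < k i)%N) (alpha : R) p dp
    (c1 c2 : R -> tensor R n k) :
  0 < alpha -> pre_segre_veronese p -> pre_tangent p dp ->
  geodesic_from (@warped_metric R (tensor_index n k) alpha) (@segre_veronese R d n k)
    (segre k p) (tangent_expr k p dp) c1 ->
  geodesic_from (@warped_metric R (tensor_index n k) alpha) (@segre_veronese R d n k)
    (segre k p) (tangent_expr k p dp) c2 ->
  c1 1 = c2 1.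
Proof.
move=> al hp hdp [[e1 e1_gt0 g1] c10 v10] [[e2 e2_gt0 g2] c20 v20].
pose e := Num.min e1 e2.
have e0 : 0 < e by rewrite lt_min e1_gt0.
have [ee1 ee2] : e <= e1 /\ e <= e2 by rewrite !ge_min !lexx orbT.
have sub e' c : e <= e' ->
    geodesic_on (@warped_metric R (tensor_index n k) alpha) (@segre_veronese R d n k)
      (- e') (1 + e') c ->
    geodesic_on (@warped_metric R (tensor_index n k) alpha) (@segre_veronese R d n k)
      (- e) (1 + e) c.
  by move=> ee' g t /andP[? ?]; apply: g; apply/andP; split; lra.
have {}g1 := sub _ _ ee1 g1; have {}g2 := sub _ _ ee2 g2.
have i0 : - e < 0 < 1 + e by apply/andP; split; lra.
have i1 : - e < 1 < 1 + e by apply/andP; split; lra.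
pose rho t := dot (c1 t) (c1 t); pose h t := dot (velocity c1 t) (c1 t).
apply: (@linear_ode_uniq (fun s => momentum p dp (tag s)) c1 c2 h rho
  (- e) (1 + e) _ _ _ _ 0 1) => //.
- by move=> s x y; exact: momentum_skew.
- by move=> t te; split; [exact: (geodesic_rho_gt0 hk g1)|exact: (der_rho g1)].
- by move=> t te; exact: (geodesic_ode hk al g1 i0 hp hdp c10 v10).
(* The initial data determine [rho] and [h], so both curves solve the same linear equation. *)
- move=> t te; have -> : rho t = dot (c2 t) (c2 t).
    by rewrite /rho (geodesic_rho hk al g1 i0 te) (geodesic_rho hk al g2 i0 te) c10 c20 v10 v20.
  have -> : h t = dot (velocity c2 t) (c2 t).
    by rewrite /h (geodesic_h hk al g1 i0 te) (geodesic_h hk al g2 i0 te) c10 c20 v10 v20.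
  exact: (geodesic_ode hk al g2 i0 hp hdp c20 v20).
- by rewrite c10 c20.
Qed.

End Uniqueness.

(** * Existence of geodesics *)

Section Rotation.
Context {R : realType} {d : nat} (n k : 'I_d -> nat).
Implicit Types (p dp : pre_point R n).

Variables (alpha M a b : R) (rho h : R -> R) (kappa : 'I_d -> R).
Variables u w : R -> forall i, vec R (n i).
Hypothesis hk : forall i, (0 < k i)%N.
Hypothesis rho_gt0 : forall t, a < t < b -> 0 < rho t.
Hypothesis drho : forall t, a < t < b -> is_derive t 1 rho (2 * h t).
Hypothesis dh : forall t, a < t < b -> is_derive t 1 h M.
(** Conservation of energy: the factor [u t i] has squared speed [kappa i / rho t ^+ 2], and M is
    the energy of the curve. *)
Hypothesis rhoE : forall t, a < t < b ->
  M * rho t - h t ^+ 2 = alpha ^+ 2 * \sum_i (k i)%:R * kappa i.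
Hypothesis uu : forall t i, dot (u t i) (u t i) = 1.
Hypothesis wu : forall t i, dot (w t i) (u t i) = 0.
Hypothesis ww : forall t i, dot (w t i) (w t i) = kappa i.
Hypothesis du : forall t i, a < t < b ->
  has_velocity (u^~ i) t ((rho t)^-1 *: w t i).
Hypothesis dw : forall t i, a < t < b ->
  has_velocity (w^~ i) t (- (kappa i / rho t) *: u t i).

Let r t := Num.sqrt (rho t).
Let U t : tensor R n k := elementary (block_family (u t)).
Let V t : tensor R n k := elementary_diff (block_family (u t)) (block_family (w t)).

Definition rotating_curve (t : R) : tensor R n k := r t *: U t.

Let r_gt0 t : a < t < b -> 0 < r t.
Proof. by move=> /rho_gt0; rewrite sqrtr_gt0. Qed.

Let r2 t : a < t < b -> rho t = r t ^+ 2.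
Proof. by move=> /rho_gt0 /ltW t0; rewrite sqr_sqrtr. Qed.

Let dr t : a < t < b -> is_derive t 1 r (h t / r t).
Proof.
move=> tab; have r0 := lt0r_neq0 (r_gt0 tab).
apply: is_derive_eq (der_comp (is_derive1_sqrt (rho_gt0 tab)) (drho tab)) _.
by rewrite -/(r t); field.
Qed.

Lemma rotating_curve_velocity t : a < t < b ->
  has_velocity rotating_curve t (h t / r t *: U t + (r t)^-1 *: V t).
Proof.
move=> tab; have r0 := lt0r_neq0 (r_gt0 tab).
have dus (s : slot k) : has_velocity (fun t => block_family (u t) s) t
    ((rho t)^-1 *: block_family (w t) s) by exact: du.
have := has_velocityZ (dr tab) (has_velocity_elementary dus).
rewrite elementary_diffZ scalerA.
by have -> : r t * (rho t)^-1 = (r t)^-1 by rewrite r2 //; field.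
Qed.

(** [w'], [u'] and [V'] are the time derivatives of the slot vectors of w and u and of V; [V'] is a
    sum over ordered pairs of slots. *)
Let w' t : slot_family R n k := fun s => - (kappa (tag s) / rho t) *: block_family (u t) s.
Let u' t : slot_family R n k := fun s => (rho t)^-1 *: block_family (w t) s.
Let V' t : tensor R n k :=
  \sum_s elementary_diff (replace s (block_family (w t)) (block_family (u t)))
    (replace s (w' t) (u' t)).

Let dV t : a < t < b -> has_velocity V t (V' t).
Proof.
move=> tab; apply: has_velocity_sum => s; apply: has_velocity_elementary => s'.
by rewrite /replace; case: eqP => _; [exact: dw|exact: du].
Qed.

Let dU t : a < t < b -> has_velocity U t ((rho t)^-1 *: V t).
Proof.
move=> tab; rewrite -elementary_diffZ; apply: has_velocity_elementary => s.
exact: du.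
Qed.

Lemma rotating_curve_acceleration t : a < t < b ->
  has_velocity (velocity rotating_curve) t
    ((M / r t - h t ^+ 2 / r t ^+ 3) *: U t + (r t)^-1 *: V' t).
Proof.
move=> tab; have r0 := lt0r_neq0 (r_gt0 tab).
pose f s := h s / r s *: U s + (r s)^-1 *: V s.
apply: (@has_velocity_near _ _ f).
  apply: filterS (near_itvoo tab) => s sab.
  by have [_ ->] := (has_velocityP _ _ _).1 (rotating_curve_velocity sab).
have di := derV r0 (dr tab).
have := has_velocityD (has_velocityZ (derM (dh tab) di) (dU tab))
  (has_velocityZ di (dV tab)).
congr has_velocity; move: (U t) (V t) (V' t) => X Y Z.
apply/ffunP => J; rewrite !ffunE /GRing.scale /= r2 //.
by field.
Qed.

Let pU t : a < t < b -> pre_segre_veronese (r t, u t).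
Proof. by move=> tab; split=> [|i]; [exact: r_gt0|apply/enorm_unit; exact: uu]. Qed.

Let rotating_segre t : rotating_curve t = segre k (r t, u t).
Proof. by rewrite segre_elementary. Qed.

Let wus t (s : slot k) : dot (block_family (w t) s) (block_family (u t) s) = 0.
Proof. exact: wu. Qed.

Let uus t (s : slot k) : dot (block_family (u t) s) (block_family (u t) s) = 1.
Proof. exact: uu. Qed.

(** Varying the same slot twice gives a multiple of [U t]. Varying two different slots gives a
    tensor orthogonal to [U t] and to the first variations. *)
Lemma dot_second_variation t y :
  (forall s : slot k, dot (y s) (block_family (u t) s) = 0) ->
  dot (V' t) (U t) = - (\sum_i (k i)%:R * kappa i) / rho t /\
  dot (V' t) (elementary_diff (block_family (u t)) y) = 0.
Proof.
move=> yu; set v := block_family (u t).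
have same s : elementary (replace s (replace s (w' t) (u' t)) (replace s (block_family (w t)) v)) =
    - (kappa (tag s) / rho t) *: U t.
  have -> : replace s (replace s (w' t) (u' t)) (replace s (block_family (w t)) v) =
      fun s' => (if s' == s then - (kappa (tag s) / rho t) else 1) *: v s'.
    apply/functional_extensionality_dep => s'; rewrite /replace.
    by have [->|_] := eqVneq s' s; rewrite ?eqxx ?scale1r.
  rewrite (elementaryZ (fun s' => if s' == s then - (kappa (tag s) / rho t) else 1)).
  congr (_ *: _); rewrite (prod_replace s (fun=> - (kappa (tag s) / rho t)) (fun=> 1)).
  by rewrite big1 ?mulr1.
have u'u s : dot (u' t s) (v s) = 0 by rewrite /u' dotZl wus mulr0.
have other s s' : s' != s ->
    dot (elementary (replace s' (replace s (w' t) (u' t)) (replace s (block_family (w t)) v)))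
      (U t) = 0 /\
    dot (elementary (replace s' (replace s (w' t) (u' t)) (replace s (block_family (w t)) v)))
      (elementary_diff v y) = 0.
  move=> ss'.
  have -> : replace s' (replace s (w' t) (u' t)) (replace s (block_family (w t)) v) =
      replace s' (u' t) (replace s (block_family (w t)) v).
    apply/functional_extensionality_dep => x; rewrite /replace.
    by have [->|//] := eqVneq x s'; rewrite (negPf ss').
  by apply: dot_replace_replace => //; rewrite eq_sym.
split; rewrite dot_suml.
  rewrite -(sum_slot_tag k kappa) -sumrN mulr_suml; apply: eq_bigr => s _.
  rewrite dot_suml (bigD1 s) //= same big1 => [|s' ss']; last by have [] := other _ _ ss'.
  by rewrite dotZl dot_elementary_unit // mulr1 addr0 mulNr.
have Uy : dot (U t) (elementary_diff v y) = 0 by rewrite dotC; exact: (dot_diff_unit (@uus t) yu).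
rewrite big1 // => s _; rewrite dot_suml (bigD1 s) //= same dotZl Uy mulr0 add0r.
by rewrite big1 // => s' ss'; have [] := other _ _ ss'.
Qed.

Lemma rotating_curve_geodesic :
  geodesic_on (@warped_metric R (tensor_index n k) alpha) (@segre_veronese R d n k)
    a b rotating_curve.
Proof.
move=> t tab; have [r0 pt] := (lt0r_neq0 (r_gt0 tab), pU tab).
have [dc vc] := (has_velocityP _ _ _).1 (rotating_curve_velocity tab).
have [da va] := (has_velocityP _ _ _).1 (rotating_curve_acceleration tab).
split=> //; first by rewrite rotating_segre; exists (r t, u t).
move=> z; rewrite rotating_segre => /(tangent_lift hk pt)[[zeta y] [/= ty ->]].
have yu (s : slot k) : dot (block_family y s) (block_family (u t) s) = 0.
  by rewrite dotC; exact: ty.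
have UU : dot (U t) (U t) = 1 by exact: dot_elementary_unit.
have VU : dot (V t) (U t) = 0 by exact: dot_diff_unit.
have VV : dot (V t) (V t) = \sum_i (k i)%:R * kappa i.
  rewrite dot_diff2 // -(sum_slot_tag k kappa).
  by apply: eq_bigr => s _; exact: ww.
have [V'U V'Y] := dot_second_variation yu.
have YU : dot (elementary_diff (block_family (u t)) (block_family y)) (U t) = 0.
  exact: dot_diff_unit.
have cc : dot (rotating_curve t) (rotating_curve t) != 0.
  by rewrite dotZl dotZr UU mulr1 mulf_neq0.
rewrite (cov_acceleration_warped alpha _ cc vc va) tangent_expr_elementary /=.
rewrite /rotating_curve -/(U t) !(dotDl, dotZl, dotDr, dotZr) UU VU VV V'U V'Y YU.
rewrite (dotC (U t) (elementary_diff _ _)) (dotC (U t) (V t)) YU VU.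
have := rhoE tab; rewrite r2 //; set Kt := \sum_i _ => e.
have -> : M = (h t ^+ 2 + alpha ^+ 2 * Kt) / r t ^+ 2.
  by rewrite -e; field.
by field.
Qed.

End Rotation.

Section Angle.
Context {R : realType}.
Implicit Types m s l mu q t : R.

Lemma atan_sin_cos s : 0 < cos (atan s) /\ sin (atan s) = s * cos (atan s).
Proof.
have c0 : 0 < cos (atan s) by rewrite cos_gt0_pihalf // atan_gtNpi2 atan_ltpi2.
by split=> //; rewrite -{2}[s]atanK /tan divfK ?lt0r_neq0.
Qed.

(** The right-hand side has the prescribed tangent and lies strictly between -pi/2 and pi/2, because
    [atan s < atan (m + s)]. *)
Lemma atan_addition m s : 0 < m ->
  atan ((s ^+ 2 + 1 + m * s) / m) = pi / 2 + atan s - atan (m + s).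
Proof.
move=> m0; have [c1 s1] := atan_sin_cos s; have [c2 s2] := atan_sin_cos (m + s).
have lt12 : atan s < atan (m + s) by apply: lt_atan; rewrite ltrDr.
have := atan_gtNpi2 s; have := atan_ltpi2 (m + s) => h2 h1.
set x := RHS; have xE : x = (atan s - atan (m + s)) + pi / 2 by rewrite /x; ring.
have <- : tan x = (s ^+ 2 + 1 + m * s) / m.
  rewrite /tan xE sinDpihalf cosDpihalf cosB sinB s1 s2.
  set X := cos (atan s); set Y := cos (atan (m + s)).
  have -> : X * Y + s * X * ((m + s) * Y) = (s ^+ 2 + 1 + m * s) * (X * Y) by ring.
  have -> : - (s * X * Y - X * ((m + s) * Y)) = m * (X * Y) by ring.
  by rewrite -mulf_div divff ?mulr1 // mulf_neq0 // lt0r_neq0.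
apply: tanK; rewrite in_itv /= xE; apply/andP; split; lra.
Qed.

End Angle.

(** * The explicit geodesic with given initial data *)

Section ExplicitGeodesic.
Context {R : realType} {d : nat} (n k : 'I_d -> nat).
Variables (alpha : R) (p dp : pre_point R n).
Hypothesis hk : forall i, (0 < k i)%N.
Hypothesis alpha_gt0 : 0 < alpha.
Hypothesis (hp : pre_segre_veronese p) (hdp : pre_tangent p dp).

Let N := weighted_norm k dp.
Let q := p.1 * alpha * N.
Let M := dp.1 ^+ 2 + q ^+ 2.
(** Equal to [(p.1 + dp.1 * t) ^+ 2 + (q * t) ^+ 2], the squared distance to the origin along a
    straight line in a plane; M is the squared warped length of the initial velocity. *)
Let rho (t : R) : R := M * t ^+ 2 + 2 * p.1 * dp.1 * t + p.1 ^+ 2.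
Let h (t : R) : R := M * t + p.1 * dp.1.

Lemma sqr_weighted_norm : N ^+ 2 = \sum_i (k i)%:R * dot (dp.2 i) (dp.2 i).
Proof.
rewrite sqr_sqrtr; last by apply: sumr_ge0 => i _; rewrite mulr_ge0 ?sqr_ge0.
by apply: eq_bigr => i _; rewrite sqr_enorm.
Qed.

Let der_rho (t : R) : is_derive t 1 rho (2 * h t).
Proof.
apply: is_derive_eq (derD (derD (derZ M (derM (der_id t) (der_id t)))
  (derZ (2 * p.1 * dp.1) (der_id t))) (der_cst t (p.1 ^+ 2))) _.
by rewrite /h; ring.
Qed.

Let der_h (t : R) : is_derive t 1 h M.
Proof.
apply: is_derive_eq (derD (derZ M (der_id t)) (der_cst t (p.1 * dp.1))) _.
by ring.
Qed.

Let rho_h t : M * rho t = h t ^+ 2 + p.1 ^+ 2 * q ^+ 2.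
Proof. by rewrite /rho /h /M; ring. Qed.

(* For dp.2 i = 0 the quotient is 0 / 0 = 0, and the rotation is constant. *)
Definition rotation (phi : R) i : vec R (n i) :=
  cos (enorm (dp.2 i) * phi) *: p.2 i +
  (sin (enorm (dp.2 i) * phi) / enorm (dp.2 i)) *: dp.2 i.

(** The derivative of [rotation] in phi, times [p.1 ^+ 2]: with phi' = [p.1 ^+ 2 / rho t] the
    factors then satisfy u' = w / rho. *)
Definition rotation_dir (phi : R) i : vec R (n i) :=
  p.1 ^+ 2 *: (cos (enorm (dp.2 i) * phi) *: dp.2 i -
  (enorm (dp.2 i) * sin (enorm (dp.2 i) * phi)) *: p.2 i).

Let pp i : dot (p.2 i) (p.2 i) = 1.
Proof. exact/enorm_unit/hp.2. Qed.

Let dpp i : dot (dp.2 i) (p.2 i) = 0.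
Proof. by rewrite dotC; exact: hdp. Qed.

Let enorm0 i : enorm (dp.2 i) = 0 -> dp.2 i = 0.
Proof. by move=> e; apply: dot_eq0; rewrite -sqr_enorm e expr0n. Qed.

Lemma rotation_unit phi i : dot (rotation phi i) (rotation phi i) = 1.
Proof.
rewrite /rotation !(dotDl, dotDr, dotZl, dotZr) pp dpp hdp -sqr_enorm.
set l := enorm _; have [->|l0] := eqVneq l 0; first by rewrite mul0r cos0; ring.
transitivity (cos (l * phi) ^+ 2 + sin (l * phi) ^+ 2); last exact: cos2Dsin2.
by field.
Qed.

Lemma rotation_dir_orth phi i : dot (rotation_dir phi i) (rotation phi i) = 0.
Proof.
rewrite /rotation /rotation_dir !(dotDl, dotDr, dotZl, dotZr, dotNl) pp dpp hdp -sqr_enorm.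
set l := enorm _; have [->|l0] := eqVneq l 0; first by rewrite mul0r sin0; ring.
by field.
Qed.

Lemma rotation_dir_sqr phi i : dot (rotation_dir phi i) (rotation_dir phi i) =
  p.1 ^+ 4 * dot (dp.2 i) (dp.2 i).
Proof.
rewrite /rotation_dir dotZl dotZr dotBl !dotBr !(dotZl, dotZr) pp dpp hdp -sqr_enorm.
set l := enorm _.
transitivity (p.1 ^+ 4 * l ^+ 2 * (cos (l * phi) ^+ 2 + sin (l * phi) ^+ 2)).
  by ring.
by rewrite cos2Dsin2 mulr1.
Qed.

Section Angle.
Variables (phi : R -> R) (t f : R).
Hypothesis dphi : is_derive t 1 phi f.

Let der_cos l : is_derive t 1 (fun s => cos (l * phi s)) (- sin (l * phi t) * (l * f)).
Proof. exact: der_comp (is_derive_cos _) (derZ l dphi). Qed.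

Let der_sin l : is_derive t 1 (fun s => sin (l * phi s)) (cos (l * phi t) * (l * f)).
Proof. exact: der_comp (is_derive_sin _) (derZ l dphi). Qed.

Lemma der_rotation i : has_velocity (fun s => rotation (phi s) i) t
  (f / p.1 ^+ 2 *: rotation_dir (phi t) i).
Proof.
have p0 := lt0r_neq0 hp.1.
pose l := enorm (dp.2 i).
have := has_velocityD
  (has_velocityZ (der_cos l) (has_velocity_cst (p.2 i) t))
  (has_velocityZ (derM (der_sin l) (der_cst t l^-1)) (has_velocity_cst (dp.2 i) t)).
congr has_velocity; rewrite /rotation_dir -/l !scaler0 !addr0.
have [l0|l0] := eqVneq l 0.
  apply/ffunP => j; rewrite (enorm0 l0) l0 !ffunE /GRing.scale /=; ring.
apply/ffunP => j; rewrite !ffunE /GRing.scale /=; field.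
by apply/andP; split.
Qed.

Lemma der_rotation_dir i : has_velocity (fun s => rotation_dir (phi s) i) t
  (- (p.1 ^+ 2 * f * dot (dp.2 i) (dp.2 i)) *: rotation (phi t) i).
Proof.
pose l := enorm (dp.2 i).
have := has_velocityZ (der_cst t (p.1 ^+ 2)) (has_velocityB
  (has_velocityZ (der_cos l) (has_velocity_cst (dp.2 i) t))
  (has_velocityZ (derZ l (der_sin l)) (has_velocity_cst (p.2 i) t))).
congr has_velocity; rewrite /rotation -sqr_enorm -/l scale0r add0r !scaler0 !addr0.
have [l0|l0] := eqVneq l 0.
  by rewrite l0 !mul0r !mulr0 !scale0r subrr scaler0 expr0n /= mulr0 oppr0 scale0r.
by apply/ffunP => j; rewrite !ffunE /GRing.scale /=; field.
Qed.

End Angle.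

(** The angle and the interval stay abstract: for N > 0 the angle is a difference of arctangents,
    for N = 0 it is rational and [rho] may vanish outside a small neighbourhood of [0, 1]. *)
Lemma explicit_geodesic (phi : R -> R) (e : R) : 0 < e ->
  (forall t, - e < t < 1 + e -> 0 < rho t) ->
  (forall t, - e < t < 1 + e -> is_derive t 1 phi (p.1 ^+ 2 / rho t)) ->
  phi 0 = 0 ->
  exists2 c, geodesic_from (@warped_metric R (tensor_index n k) alpha)
      (@segre_veronese R d n k) (segre k p) (tangent_expr k p dp) c &
    c 1 = segre k (Num.sqrt ((p.1 + dp.1) ^+ 2 + q ^+ 2), rotation (phi 1)).
Proof.
move=> e0 rho0 dphi phi0; have p0 := lt0r_neq0 hp.1.
pose u t := rotation (phi t); pose w t := rotation_dir (phi t).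
pose kappa i := p.1 ^+ 4 * dot (dp.2 i) (dp.2 i).
have i0 : - e < 0 < 1 + e by apply/andP; split; lra.
have rhoE t : - e < t < 1 + e ->
    M * rho t - h t ^+ 2 = alpha ^+ 2 * \sum_i (k i)%:R * kappa i.
  move=> _; rewrite rho_h.
  have -> : \sum_i (k i)%:R * kappa i = p.1 ^+ 4 * N ^+ 2.
    by rewrite sqr_weighted_norm mulr_sumr; apply: eq_bigr => i _; rewrite /kappa mulrCA.
  by rewrite /q; ring.
have uu t i : dot (u t i) (u t i) = 1 by exact: rotation_unit.
have wu t i : dot (w t i) (u t i) = 0 by exact: rotation_dir_orth.
have ww t i : dot (w t i) (w t i) = kappa i by exact: rotation_dir_sqr.
have du t i : - e < t < 1 + e -> has_velocity (u^~ i) t ((rho t)^-1 *: w t i).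
  move=> te; have := der_rotation (i := i) (dphi t te); congr has_velocity.
  by congr (_ *: _); field; rewrite p0 lt0r_neq0 // rho0.
have dw t i : - e < t < 1 + e ->
    has_velocity (w^~ i) t (- (kappa i / rho t) *: u t i).
  move=> te; have := der_rotation_dir (i := i) (dphi t te); congr has_velocity.
  by congr (- _ *: _); rewrite /kappa; field; rewrite lt0r_neq0 // rho0.
have dr t (te : - e < t < 1 + e) := der_rho t.
have dh t (te : - e < t < 1 + e) := der_h t.
have u0 : u 0 = p.2.
  apply/functional_extensionality_dep => i.
  by rewrite /u /rotation phi0 mulr0 cos0 sin0 mul0r scale0r addr0 scale1r.
have w0 : w 0 = fun i => p.1 ^+ 2 *: dp.2 i.
  apply/functional_extensionality_dep => i.
  by rewrite /w /rotation_dir phi0 mulr0 cos0 sin0 mulr0 scale0r subr0 scale1r.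
have rho00 : rho 0 = p.1 ^+ 2 by rewrite /rho; ring.
have sq0 : Num.sqrt (rho 0) = p.1 by rewrite rho00 sqrtr_sqr ger0_norm // ltW // hp.1.
exists (rotating_curve k rho u).
  split.
  - by exists e => //; exact: (rotating_curve_geodesic hk rho0 dr dh rhoE uu wu ww du dw).
  - by rewrite /rotating_curve sq0 u0 segre_elementary.
  - have := rotating_curve_velocity (k := k) rho0 dr du i0.
    move=> /has_velocityP[_ ->]; rewrite sq0 u0 w0 tangent_expr_elementary.
    rewrite (elementary_diffZ _ (block_family dp.2)) scalerA.
    by congr (_ *: _ + _ *: _); rewrite /h; field.
rewrite segre_elementary /rotating_curve; congr (Num.sqrt _ *: _).
by rewrite /rho /M; ring.
Qed.

Lemma pre_exp_geodesic : pre_exp_domain k p dp ->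
  exists2 c, geodesic_from (@warped_metric R (tensor_index n k) alpha)
      (@segre_veronese R d n k) (segre k p) (tangent_expr k p dp) c &
    c 1 = segre k (pre_exp k alpha p dp).
Proof.
move=> dom; have p_gt0 := hp.1; have p0 := lt0r_neq0 hp.1.
rewrite /pre_exp -/N; case: ifPn => [N_gt0|].
  have q_gt0 : 0 < q by rewrite !mulr_gt0.
  have q0 := lt0r_neq0 q_gt0.
  have M_gt0 : 0 < M by rewrite ltr_wpDl ?sqr_ge0// exprn_gt0.
  have rho_gt0 t : 0 < rho t.
    rewrite -(pmulr_rgt0 _ M_gt0) rho_h ltr_wpDl ?sqr_ge0//.
    by rewrite mulr_gt0 // exprn_gt0.
  have aN0 : alpha * N != 0 by rewrite lt0r_neq0 // mulr_gt0.
  (* The primitive of [p.1 ^+ 2 / rho t] vanishing at 0, found by completing the square as in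
     [rho_h]. *)
  pose phi t := (alpha * N)^-1 * (atan (h t / (p.1 * q)) - atan (dp.1 / q)).
  have dphi (t : R) : is_derive t 1 phi (p.1 ^+ 2 / rho t).
    apply: is_derive_eq (derZ (alpha * N)^-1 (derB (der_comp (is_derive1_atan _)
      (derM (der_h t) (der_cst t (p.1 * q)^-1))) (der_cst t (atan (dp.1 / q))))) _.
    have -> : rho t = (h t ^+ 2 + p.1 ^+ 2 * q ^+ 2) / M.
      by rewrite -rho_h mulrC mulKf // lt0r_neq0.
    have s0 : h t ^+ 2 + p.1 ^+ 2 * q ^+ 2 != 0.
      by rewrite -rho_h mulf_neq0 // lt0r_neq0.
    have aN : alpha * N = q / p.1 by rewrite /q; field.
    rewrite aN mulr0 addr0 subr0; field.
    by rewrite exprMn s0 p0 q0 lt0r_neq0.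
  have phi0 : phi 0 = 0.
    rewrite /phi /h mulr0 add0r -mulf_div divff // mul1r subrr mulr0 //.
  have phi1 : phi 1 = (alpha * N)^-1 * (pi / 2 - atan ((p.1 + dp.1) / q)).
    rewrite /phi; congr (_ * _).
    (* This is the shape of [atan_addition] with m = [p.1 / q] and s = [dp.1 / q]. *)
    have -> : h 1 / (p.1 * q) = ((dp.1 / q) ^+ 2 + 1 + p.1 / q * (dp.1 / q)) / (p.1 / q).
      by rewrite /h /M; field; rewrite p0 q0.
    rewrite atan_addition ?divr_gt0 // -mulrDl; ring.
  have [c gc c1] := explicit_geodesic ltr01 (fun t _ => rho_gt0 t) (fun t _ => dphi t) phi0.
  exists c => //; rewrite c1 -/q; congr (segre k (_, _)).
  apply/functional_extensionality_dep => i; rewrite -phi1 /sphere_exp /rotation.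
  have phi1_gt0 : 0 < phi 1.
    by rewrite phi1 mulr_gt0 ?invr_gt0 ?mulr_gt0 // subr_gt0 atan_ltpi2.
  rewrite enormZ gtr0_norm // scaler_eq0 (gt_eqF phi1_gt0) /=.
  have [->|dp0] := eqVneq (dp.2 i) 0.
    by rewrite /enorm dot0l sqrtr0 mul0r cos0 scale1r scaler0 addr0.
  have l0 : enorm (dp.2 i) != 0 by apply: contraNneq dp0 => /enorm0 ->.
  rewrite scalerA mulrC; congr (_ *: _ + _ *: _); rewrite mulrC.
  by field; rewrite l0 lt0r_neq0.
rewrite -leNgt => N_le0.
have N0 : N = 0 by apply/eqP; rewrite eq_le N_le0 sqrtr_ge0.
have dp0 i : dp.2 i = 0.
  apply: dot_eq0; have /esym/eqP := sqr_weighted_norm; rewrite N0 expr0n /=.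
  rewrite psumr_eq0 => [/allP /(_ i)|j _]; last by rewrite mulr_ge0 ?dot_ge0.
  rewrite mem_index_enum => /(_ isT) /=.
  by rewrite mulf_eq0 pnatr_eq0 eqn0Ngt hk /= => /eqP.
have q0 : q = 0 by rewrite /q N0 mulr0.
have dp1 : 0 < p.1 + dp.1.
  by case: dom => [|?]; [rewrite -/N N0 ltxx|lra].
(* The affine function [p.1 + dp.1 * t] is positive at 0 and at 1; over a length e it changes by
   less than the smaller of these two values. The summand 1 keeps the denominator positive when
   [dp.1 = 0]. *)
pose e := Num.min p.1 (p.1 + dp.1) / (`|dp.1| + 1).
have B0 : 0 < `|dp.1| + 1 by rewrite ltr_wpDl.
have e0 : 0 < e by rewrite divr_gt0 // lt_min p_gt0.
have eB : e * (`|dp.1| + 1) = Num.min p.1 (p.1 + dp.1).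
  by rewrite divfK // lt0r_neq0.
have [eB1 eB2] : e * (`|dp.1| + 1) <= p.1 /\ e * (`|dp.1| + 1) <= p.1 + dp.1.
  by rewrite eB !ge_min !lexx orbT.
have lin (t : R) : - e < t < 1 + e -> 0 < p.1 + dp.1 * t.
  move=> /andP[te1 te2]; have [dpos|dneg] := ger0P dp.1.
    by rewrite ger0_norm // in eB1; nra.
  by rewrite ltr0_norm // in eB2; nra.
have rhoE t : rho t = (p.1 + dp.1 * t) ^+ 2 by rewrite /rho /M q0; ring.
have rho_gt0 (t : R) : - e < t < 1 + e -> 0 < rho t.
  by move=> te; rewrite rhoE exprn_gt0 // lin.
(* The primitive of [p.1 ^+ 2 / (p.1 + dp.1 * t) ^+ 2] vanishing at 0, valid also for [dp.1 = 0]. *)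
pose phi t := p.1 * t * (p.1 + dp.1 * t)^-1.
have dphi (t : R) : - e < t < 1 + e -> is_derive t 1 phi (p.1 ^+ 2 / rho t).
  move=> te; have l0 := lt0r_neq0 (lin t te).
  have dl := derD (der_cst t p.1) (derZ dp.1 (der_id t)).
  apply: is_derive_eq (derM (derZ p.1 (der_id t))
    (derV (f := fun s => p.1 + dp.1 * s) l0 dl)) _.
  by rewrite rhoE; field.
have phi0 : phi 0 = 0 by rewrite /phi mulr0 mul0r.
have [c gc c1] := explicit_geodesic e0 rho_gt0 dphi phi0.
exists c => //; rewrite c1 q0 expr0n addr0 sqrtr_sqr ger0_norm ?ltW //.
congr (segre k (_, _)); apply/functional_extensionality_dep => i.
by rewrite /rotation dp0 /enorm dot0l sqrtr0 mul0r cos0 scale1r scaler0 addr0.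
Qed.

End ExplicitGeodesic.

(** * Unique lifts and the exponential map of the cone *)

Theorem corollary3p3 (R : realType) (d : nat) (n k : 'I_d -> nat) (alpha : R)
    (hd : (1 <= d)%N) (hn : forall i, (0 < n i)%N) (hk : forall i, (0 < k i)%N)
    (halpha : 0 < alpha)
    (P : tensor R n k) (hP : segre_veronese P)
    (p : pre_point R n) (hp : pre_segre_veronese p) (hpP : segre k p = P)
    (dP : tensor R n k) (hdP : tangent_space (@segre_veronese R d n k) P dP) :
  (exists! dp : pre_point R n, lifted_tangent p dP dp) /\
  (forall dp : pre_point R n, lifted_tangent p dP dp ->
     pre_exp_domain k p dp ->
     exp_domain (@warped_metric R (tensor_index n k) alpha)
       (@segre_veronese R d n k) P dP /\
     exp_map (@warped_metric R (tensor_index n k) alpha)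
       (@segre_veronese R d n k) P dP = segre k (pre_exp k alpha p dp)).
Proof.
rewrite -hpP in hdP *; split.
  have [dp lift] := tangent_lift hk hp hdP.
  by exists dp; split=> // dp'; exact: (lifted_tangent_uniq hk hp lift).
move=> dp [hdp ->] dom.
have [c gc c1] := pre_exp_geodesic hk halpha hp hdp dom.
split; first by exists c.
(* [xget] selects the endpoint of some geodesic c', equal to that of c by uniqueness; the existence
   of c rules out the default value 0. *)
rewrite /exp_map; case: xgetP => [y _ [c' gc' <-]|/(_ (c 1))[]]; last by exists c.
by rewrite -c1; exact: (geodesic_uniq hk halpha hp hdp gc' gc).
Qed.
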